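(* Let $(M,\bar g,u)$ be a non-Einstein, complete, expanding gradient Ricci soliton of cohomogeneity one with a special orbit. Then the soliton potential $u$, viewed as a function of $t$, is strictly decreasing and strictly concave on $(0,\infty)$.
   Context: An expanding gradient Ricci soliton is $(M,\bar g,u)$, with $\bar g$ a smooth Riemannian metric and $u$ a smooth function, satisfying $\mathrm{Ric}(\bar g)+\mathrm{Hess}(u)+\frac{\epsilon}{2}\bar g=0$ for a constant $\epsilon>0$. It is complete if $\bar g$ is complete, and non-Einstein if $\bar g$ is not an Einstein metric. ''Cohomogeneity one with a special orbit'' refers to the following setting. $M$ is noncompact of dimension $n+1$. There is a compact submanifold of $M$ (the special orbit) such that, with $t\in[0,\infty)$ the distance from it, the complement is identified with $(0,\infty)\times P$ with $P$ a compact $n$-manifold, and $\bar g=dt^2+g_t$ there, where $g_t$ is a metric on the hypersurface $P_t=\{t\}\times P$. As $t\to0$ the hypersurfaces collapse smoothly onto the special orbit, which is placed at $t=0$, with collapsing spheres of dimension $k\ge1$ (so the special orbit has codimension $k+1$). The potential $u$ is a function of $t$ only. The scalar curvature $S$ of $g_t$ and the mean curvature $\mathrm{tr}\,L$ of $P_t$ with respect to $\partial/\partial t$ are constant on each $P_t$; here $L=L_t$ is the shape operator, defined by $\dot g_t=2g_tL_t$. This holds for instance if a compact Lie group acts isometrically with principal orbits $P_t$ and preserves $u$. The potential is normalized by $u(0)=0$. A dot denotes $d/dt$. *)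

(* Defs.v *)
From HB Require Import structures.
From mathcomp Require Import all_boot all_order all_algebra.
From mathcomp Require Import all_classical all_reals all_analysis.
Set Implicit Arguments.
Unset Strict Implicit.
Unset Printing Implicit Defensive.
Import Order.TTheory GRing.Theory Num.Theory.
Import numFieldNormedType.Exports.
Local Open Scope classical_set_scope.
Local Open Scope ring_scope.

(* Smooth manifolds are given by maximal atlases, and tensors by their
   components in every chart of the atlas together with the transformation
   law.  Points of R^m are row vectors; values of functions outside the domain
   of a chart (or outside its image) are junk that no definition looks at. *)

Section EuclideanCalculus.
Context {R : realType} {m : nat}.
Implicit Types (f : 'rV[R]_m -> R) (G : 'rV[R]_m -> 'M[R]_m).

Definition partial (i : 'I_m) f : 'rV[R]_m -> R :=
  fun x => 'D_(delta_mx 0 i) f x.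

(* C^oo on U (used for open U only): every iterated partial derivative, the
   function itself included, is continuous and has partial derivatives. *)
Definition smooth_on (U : set 'rV[R]_m) f : Prop :=
  forall (s : seq 'I_m) x, U x ->
    {for x, continuous (foldr partial f s)} /\
    forall i, derivable (foldr partial f s) x (delta_mx 0 i).

(* G is the matrix (g_ij) of a metric in a coordinate system. *)

(* Gamma^l_ij *)
Definition christoffel G (l i j : 'I_m) : 'rV[R]_m -> R := fun x =>
  2^-1 * \sum_r invmx (G x) l r *
    (partial i (fun y => G y r j) x + partial j (fun y => G y r i) x
     - partial r (fun y => G y i j) x).

(* Component along d_l of
   R(d_i, d_j) d_k = nabla_i nabla_j d_k - nabla_j nabla_i d_k. *)
Definition riemann G (l i j k : 'I_m) : 'rV[R]_m -> R := fun x =>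
  partial i (christoffel G l j k) x - partial j (christoffel G l i k) x
  + \sum_r (christoffel G l i r x * christoffel G r j k x
            - christoffel G l j r x * christoffel G r i k x).

(* Ric(Y, Z) = tr (X |-> R(X, Y) Z); positive on round spheres. *)
Definition ricci G (x : 'rV[R]_m) : 'M[R]_m :=
  \matrix_(j, k) \sum_l riemann G l l j k x.

Definition scalar_curvature G (x : 'rV[R]_m) : R :=
  \tr (invmx (G x) *m ricci G x).

Definition hessian G f (x : 'rV[R]_m) : 'M[R]_m :=
  \matrix_(i, j) (partial i (partial j f) x
                  - \sum_l christoffel G l i j x * partial l f x).

End EuclideanCalculus.

Record chart (R : realType) (m : nat) (T : Type) := Chart {
  dom : set T;
  coord : T -> 'rV[R]_m;
  param : 'rV[R]_m -> T
}.

Definition img (R : realType) (m : nat) (T : Type) (c : chart R m T) :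
  set 'rV[R]_m := coord c @` dom c.

Definition is_chart (R : realType) (m : nat) (T : topologicalType)
    (c : chart R m T) : Prop :=
  [/\ open (dom c), open (img c),
      forall p, dom c p -> param c (coord c p) = p,
      forall p, dom c p -> {for p, continuous (coord c)} &
      forall x, img c x -> {for x, continuous (param c)}].

Definition smooth_transition (R : realType) (m : nat) (T : Type)
    (c d : chart R m T) : Prop :=
  forall j, smooth_on (coord c @` (dom c `&` dom d))
                      (fun x => coord d (param c x) 0 j).

Definition compatible (R : realType) (m : nat) (T : Type)
    (c d : chart R m T) : Prop :=
  smooth_transition c d /\ smooth_transition d c.

Record manifold (R : realType) (m : nat) := Manifold {
  carrier :> topologicalType;
  atlas : set (chart R m carrier);
  manifold_hausdorff : hausdorff_space carrier;
  manifold_second_countable : @second_countable carrier;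
  atlas_chart : forall c, atlas c -> is_chart c;
  atlas_cover : forall p, exists2 c, atlas c & dom c p;
  atlas_compatible : forall c d, atlas c -> atlas d -> compatible c d;
  atlas_maximal : forall c, is_chart c ->
    (forall d, atlas d -> compatible c d) -> atlas c
}.

Section Riemannian.
Context {R : realType} {m : nat} (M : manifold R m).

Definition smooth_function (u : M -> R) : Prop :=
  forall c, atlas c -> smooth_on (img c) (u \o param c).

(* Components, in each chart and at each point of its image, of a
   covariant 2-tensor. *)
Definition tensor2 := chart R m M -> 'rV[R]_m -> 'M[R]_m.

(* Entry (i, j) is d y_j / d x_i for x = coord c, y = coord d. *)
Definition jacobian_mx (c d : chart R m M) (x : 'rV[R]_m) : 'M[R]_m :=
  \matrix_(i, j) partial i (fun y => coord d (param c y) 0 j) x.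

Record riemannian_metric (g : tensor2) : Prop := {
  metric_smooth : forall c i j, atlas c ->
    smooth_on (img c) (fun x => g c x i j);
  metric_sym : forall c x, atlas c -> img c x -> (g c x)^T = g c x;
  metric_pos : forall c x (v : 'rV[R]_m), atlas c -> img c x -> v != 0 ->
    0 < (v *m g c x *m v^T) 0 0;
  metric_change : forall c d p, atlas c -> atlas d -> dom c p -> dom d p ->
    g c (coord c p) = jacobian_mx c d (coord c p) *m g d (coord d p)
                      *m (jacobian_mx c d (coord c p))^T
}.

Definition einstein (g : tensor2) : Prop :=
  exists lam : R, forall c x, atlas c -> img c x ->
    ricci (g c) x = lam *: g c x.

Definition expanding_gradient_soliton (g : tensor2) (u : M -> R) (eps : R) :
    Prop :=
  [/\ 0 < eps, riemannian_metric g, smooth_function u &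
      forall c x, atlas c -> img c x ->
        ricci (g c) x + hessian (g c) (u \o param c) x + (eps / 2) *: g c x
        = 0].

(* Curves are C^1 on the whole real line, which loses no generality: a C^1
   curve on [0, 1] extends. *)
Definition C1_curve (gam : R -> M) : Prop :=
  continuous gam /\
  forall s c i, atlas c -> dom c (gam s) ->
    derivable (fun r => coord c (gam r) 0 i) s 1 /\
    {for s, continuous (derive1 (fun r => coord c (gam r) 0 i))}.

Definition velocity (c : chart R m M) (gam : R -> M) (s : R) : 'rV[R]_m :=
  \row_i derive1 (fun r => coord c (gam r) 0 i) s.

Definition has_speed (g : tensor2) (gam : R -> M) (s v : R) : Prop :=
  forall c, atlas c -> dom c (gam s) ->
    v = Num.sqrt ((velocity c gam s *m g c (coord c (gam s))
                   *m (velocity c gam s)^T) 0 0).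

(* path_length g p q l: some piecewise C^1 curve from p to q has length l. *)
Inductive path_length (g : tensor2) : M -> M -> R -> Prop :=
| path_length_piece (gam : R -> M) (v : R -> R) :
    C1_curve gam ->
    (forall s, 0 <= s <= 1 -> has_speed g gam s (v s)) ->
    path_length g (gam 0) (gam 1)
      (\int[lebesgue_measure]_(s in `[0, 1]) v s)
| path_length_cat (p q r : M) (l l' : R) :
    path_length g p q l -> path_length g q r l' ->
    path_length g p r (l + l').

Definition rdist (g : tensor2) (p q : M) : \bar R :=
  ereal_inf [set l%:E | l in path_length g p q].

Definition rdist_to (g : tensor2) (A : set M) (p : M) : \bar R :=
  ereal_inf [set rdist g p q | q in A].

Definition complete_metric (g : tensor2) : Prop :=
  forall p : nat -> M,
    (forall e : R, 0 < e -> exists i0 : nat, forall i j : nat,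
       (i0 <= i)%N -> (i0 <= j)%N -> (rdist g (p i) (p j) < e%:E)%E) ->
    exists q : M, forall e : R, 0 < e -> exists i0 : nat, forall i : nat,
       (i0 <= i)%N -> (rdist g (p i) q < e%:E)%E.

Definition slice_chart (A : set M) (r : nat) (c : chart R m M) : Prop :=
  atlas c /\
  forall p, dom c p -> (A p <-> forall i : 'I_m, (i < r)%N -> coord c p 0 i = 0).

Definition submanifold_of_codim (r : nat) (A : set M) : Prop :=
  (r <= m)%N /\ forall p, A p -> exists2 c, slice_chart A r c & dom c p.

End Riemannian.

Section CohomogeneityOne.
Context {R : realType} {n : nat} (M : manifold R n.+1) (P : manifold R n).

(* The matrix, in the chart a of P, of the endomorphism L_t determined by
   dg_t/dt = 2 g_t L_t. *)
Definition shape_operator (h : R -> tensor2 P) (t : R) (a : chart R n P)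
    (x : 'rV[R]_n) : 'M[R]_n :=
  2^-1 *: (invmx (h t a x) *m
           \matrix_(i, j) derive1 (fun s => h s a x i j) t).

(* c is the chart (t, x) on Phi((0, oo) x dom a), where x = coord a. *)
Definition product_chart (Phi : R -> P -> M) (a : chart R n P)
    (c : chart R n.+1 M) : Prop :=
  dom c = [set q | exists t p, [/\ 0 < t, dom a p & q = Phi t p]] /\
  forall t p, 0 < t -> dom a p ->
    coord c (Phi t p) = row_mx (t%:M : 'rV[R]_1) (coord a p).

(* The curves s |-> Phi s p are the radial rays v = s theta, |theta| = 1, of
   the normal coordinates v = (x_0, ..., x_k) in the chart c around a point of
   the special orbit N, the tangential coordinates being constant along them.
   So locally {v = 0} = N and {|v| = t} = P_t. *)
Definition polar_chart (N : set M) (k : nat) (Phi : R -> P -> M)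
    (c : chart R n.+1 M) : Prop :=
  slice_chart N k.+1 c /\
  forall t p, 0 < t -> dom c (Phi t p) ->
    \sum_(i < n.+1 | (i <= k)%N) coord c (Phi t p) 0 i ^+ 2 = t ^+ 2 /\
    forall s, 0 < s <= t ->
      dom c (Phi s p) /\
      forall i : 'I_n.+1, coord c (Phi s p) 0 i =
        if (i <= k)%N then s / t * coord c (Phi t p) 0 i
        else coord c (Phi t p) 0 i.

(* g is the metric of M, N the special orbit, Phi the identification of
   (0, oo) x P with the complement of N, h t the metric g_t on P, and f the
   potential u as a function of t. *)
Record cohomogeneity_one (k : nat) (g : tensor2 M) (u : M -> R) (N : set M)
    (Phi : R -> P -> M) (h : R -> tensor2 P) (f : R -> R) : Prop := {
  coh1_noncompact : ~ compact [set: M];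
  coh1_orbit_compact : compact [set: P];
  coh1_sphere_dim : (1 <= k)%N;
  coh1_special_compact : compact N;
  coh1_special_codim : submanifold_of_codim k.+1 N;
  coh1_bij : set_bij [set z : R * P | 0 < z.1] (~` N) (fun z => Phi z.1 z.2);
  coh1_diffeo : forall a, atlas a ->
    exists2 c, atlas c & product_chart Phi a c;
  coh1_distance : forall t p, 0 < t -> rdist_to g N (Phi t p) = t%:E;
  coh1_slice_metric : forall t, 0 < t -> riemannian_metric (h t);
  coh1_metric : forall a c t x, atlas a -> atlas c -> product_chart Phi a c ->
    0 < t -> img a x ->
    g c (row_mx (t%:M : 'rV[R]_1) x)
    = block_mx (1%:M : 'M[R]_1) 0 0 (h t a x) :> 'M[R]_(1 + n);
  coh1_collapse : forall q, N q ->
    exists2 c, polar_chart N k Phi c & dom c q;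
  coh1_potential : forall t p, 0 < t -> u (Phi t p) = f t;
  coh1_potential0 : forall q, N q -> u q = f 0;
  coh1_normalized : f 0 = 0;
  coh1_scalar_const : exists S : R -> R, forall t a x, 0 < t ->
    atlas a -> img a x -> scalar_curvature (h t a) x = S t;
  coh1_mean_const : exists H : R -> R, forall t a x, 0 < t ->
    atlas a -> img a x -> \tr (shape_operator h t a x) = H t
}.

End CohomogeneityOne.

Definition strictly_decreasing_on (R : realType) (A : set R) (f : R -> R) :
    Prop :=
  forall s t, A s -> A t -> s < t -> f t < f s.

Definition strictly_concave_on (R : realType) (A : set R) (f : R -> R) : Prop :=
  forall s t a, A s -> A t -> s != t -> 0 < a < 1 ->
    a * f s + (1 - a) * f t < f (a * s + (1 - a) * t).

(* Main.v *)
From HB Require Import structures.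
Require Import Defs.
From mathcomp Require Import all_boot all_order all_algebra.
From mathcomp Require Import all_classical all_reals all_analysis.
From mathcomp Require Import ring lra.
Import Order.TTheory GRing.Theory Num.Theory.
Import numFieldNormedType.Exports.
Local Open Scope classical_set_scope.
Local Open Scope ring_scope.

(** Write [y = f'], let [L] be the shape operator of the slices, [H] its trace
    (a function of [t] alone), [q] the trace of [L ^ 2], and [xi = H - y].

    Everything rests on two ordinary differential equations on [(0, oo)]:
    - [H' = - q + y' + eps / 2], the component of the soliton equation in the
      direction [d/dt] ([soliton_time_time]);
    - [y'' + xi y' = (q + eps / 2) y] ([soliton_third_order]).
    The second one is the derivative of the conservation law
    [y' + xi y - eps f = C].  It comes from computing the time derivative of
    the scalar curvature [S] of the slices in two ways.  The slice components
    of the soliton equation give [S] and [tr (L Ric)] in terms of [L] and [f].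
    The mixed components say that [L] is divergence free, as [H] is constant
    on slices; for such a variation of the slice metric the first variation
    of scalar curvature is just [S' = - 2 tr (L Ric)]
    ([trace_dt_spatial_ricci]).  All of this is local, in one product chart,
    where the metric is [dt^2 + h(t)].

    The conclusion is then drawn from the equations.  Since
    [xi' = - q + eps / 2 <= eps / 2], the function [xi] is bounded below on
    each interval [(0, T]], and [Phi = y y'] satisfies [Phi' >= - xi Phi].
    Near the special orbit the potential is a smooth even function of [t],
    so that [Phi -> 0] at [0]; hence [Phi >= 0], and [y ^ 2] is
    nondecreasing.  If [y] is somewhere nonzero, uniqueness for the linear
    system satisfied by [f + C / eps] and [y] shows that [y] never vanishes,
    and then [Phi > 0].  This leaves three cases
    ([soliton_ode_dichotomy]).
    - [y = 0]: the potential vanishes, and the metric is Einstein.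
    - [y < 0] and [y' < 0]: this is the claim.
    - [y > 0] and [y' > 0]: the Riccati inequality
      [xi' <= eps / 2 - (xi + y) ^ 2 / n], which is Cauchy-Schwarz for [L],
      forces [xi <= - a y] for large [t], with [a > 0].  So [y' >= a y ^ 2]
      eventually, and [y] blows up in finite time
      ([no_increasing_solution]).  But [t] ranges over all of [(0, oo)]. *)

(** * Ordinary differential inequalities *)

Section RealFunctions.
Context {R : realType}.
Implicit Types (g dg : R -> R) (a b d t s : R).

Lemma is_derive_continuous g t l : is_derive t 1 g l -> {for t, continuous g}.
Proof.
move=> gl; apply/differentiable_continuous/derivable1_diffP.
exact: (@ex_derive _ _ _ _ _ _ _ gl).
Qed.

Lemma mean_value g dg a b : a < b ->
  (forall t, a <= t <= b -> is_derive t 1 g (dg t)) ->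
  exists2 c, a < c < b & g b - g a = dg c * (b - a).
Proof.
move=> ab gd; have [||c] := @MVT _ g dg a b ab.
- by move=> t; rewrite in_itv/= => /andP[/ltW a_t /ltW tb]; apply: gd; rewrite a_t.
- apply: derivable_within_continuous => t; rewrite in_itv/= => tab.
  exact: (@ex_derive _ _ _ _ _ _ _ (gd _ tab)).
- by rewrite in_itv/= => cab e; exists c.
Qed.

Lemma last_nonpositive g a b : a <= b ->
  (forall t, a <= t <= b -> {for t, continuous g}) -> g a <= 0 -> 0 < g b ->
  exists s, [/\ a <= s < b, g s <= 0 & forall t, s < t <= b -> 0 < g t].
Proof.
move=> ab gc ga gb.
pose A := [set t | a <= t <= b /\ g t <= 0].
have A0 : A a by split; rewrite ?lexx.
have Aub : ubound A b by move=> t [/andP[]].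
have Asup : has_sup A by split; [exists a | exists b].
set s := sup A.
have a_s : a <= s by apply: ub_le_sup => //; exists b.
have sb : s <= b by apply: ge_sup => //; exists a.
have sab : a <= s <= b by rewrite a_s sb.
have gs : g s <= 0.
  rewrite leNgt; apply/negP => gs0.
  have /nbhs_ballP[e /= e0 eb] : \forall t \near s, 0 < g t.
    exact: (cvgr_gt (g s) (gc s sab)).
  have [t [tab gt] st] := sup_adherent e0 Asup.
  have /eb /= : ball s e t.
    rewrite /ball/= ger0_norm ?subr_ge0 ?ub_le_sup//; last by exists b.
    by rewrite ltrBlDr addrC -ltrBlDr.
  by rewrite ltNge gt.
exists s; split => //.
  rewrite a_s lt_neqAle sb andbT; apply/eqP => e.
  by move: gs; rewrite e leNgt gb.
move=> t /andP[st tb]; rewrite ltNge; apply/negP => gt.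
have : t <= s by apply: ub_le_sup; [exists b|split; rewrite ?tb ?(le_trans a_s (ltW st))].
by rewrite leNgt st.
Qed.

(** The comparison principle for large times: a rate of decrease as long as
    [g] is positive first brings [g] down to [0], and then keeps it from
    crossing [0] upwards.  Every bound of the blow-up argument is of this
    form. *)
Lemma eventually_nonpositive g dg d : 0 < d ->
  (\forall t \near +oo, is_derive (t : R) 1 g (dg t) /\ (0 < g t -> dg t <= - d)) ->
  \forall t \near +oo, g t <= 0.
Proof.
move=> d0 [T [Treal gT]].
have gd t : T < t -> is_derive t 1 g (dg t) by move=> /gT[].
have dgd t : T < t -> 0 < g t -> dg t <= - d by move=> /gT[].
pose T0 := T + 1; have T0T : T < T0 by rewrite ltrDl.
have [T1 T01 gT1] : exists2 T1, T0 <= T1 & g T1 <= 0.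
  apply: contrapT => /forall2NP gpos.
  have {}gpos t : T0 <= t -> 0 < g t.
    by move=> tT; case: (gpos t) => [//|/negP]; rewrite ltNge.
  pose b := T0 + (g T0 / d + 1).
  have T0b : T0 < b by rewrite ltrDl addr_gt0// divr_gt0// gpos.
  have [t|c /andP[T0c cb] gb] := @mean_value g dg T0 b T0b.
    by move=> /andP[T0t _]; apply: gd; exact: lt_le_trans T0t.
  have := gpos b (ltW T0b).
  have : dg c <= - d by apply: dgd; [exact: lt_trans T0c|apply: gpos; exact: ltW].
  rewrite -(ler_pM2r (_ : 0 < b - T0)) ?subr_gt0// -gb {2}/b addrAC subrr add0r.
  rewrite mulrDr mulr1 mulrCA mulNr divff ?gt_eqF// mulrN1.
  by lra.
exists T1; split; first exact: num_real.
move=> t T1t; rewrite leNgt; apply/negP => gt.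
have [s' /andP[T1s _]||//|s [/andP[T1s st] gs gpos]] :=
    @last_nonpositive g T1 t (ltW T1t).
- apply: is_derive_continuous; apply: gd.
  by rewrite (lt_le_trans T0T)// (le_trans T01).
- exact: gT1.
have [s'|c /andP[sc ct] e] := @mean_value g dg s t st.
  move=> /andP[ss' _]; apply: gd.
  by rewrite (lt_le_trans T0T)// (le_trans T01)// (le_trans T1s).
have : dg c <= - d.
  apply: dgd; last by apply: gpos; rewrite sc ltW.
  by rewrite (lt_le_trans T0T)// (le_trans T01)// (le_trans T1s)// ltW.
rewrite -(ler_pM2r (_ : 0 < t - s)) ?subr_gt0// -e => h.
have : 0 < d * (t - s) by rewrite mulr_gt0// subr_gt0.
lra.
Qed.

End RealFunctions.

(** Blow-up.  In this order, for large [t]: [f] and then [y] are arbitrarily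
    large, [xi] is bounded above and then negative, [y'/y + xi] is bounded,
    and [xi <= - a y]; each step is [eventually_nonpositive].  At the end
    [1 / y] decreases at the rate [a] although it is positive. *)
Lemma no_increasing_solution {R : realType} (eps C m : R)
    (f y dy xi dxi : R -> R) :
  0 < eps -> 1 <= m ->
  (forall t : R, 0 < t -> is_derive (t : R) 1 f (y t)) ->
  (forall t : R, 0 < t -> is_derive (t : R) 1 y (dy t)) ->
  (forall t : R, 0 < t -> is_derive (t : R) 1 xi (dxi t)) ->
  (forall t : R, 0 < t -> dy t = eps * f t + C - xi t * y t) ->
  (forall t : R, 0 < t -> dxi t <= eps / 2 - (xi t + y t) ^+ 2 / m) ->
  ~ (forall t : R, 0 < t -> 0 < y t /\ 0 < dy t).
Proof.
move=> eps_gt0 m_ge1 f_deriv y_deriv xi_deriv conservation riccati.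
move=> ydy; have y_gt0 (t : R) : 0 < t -> 0 < y t by move=> /ydy[].
have dy_gt0 (t : R) : 0 < t -> 0 < dy t by move=> /ydy[].
have m_gt0 : 0 < m by lra.
have t_gt0 : \forall t \near +oo, 0 < (t : R) by exact: nbhs_pinfty_gt.
set c := y 1; have c_gt0 : 0 < c by exact: y_gt0.
have y_ge : \forall t \near +oo, c <= y t.
  near=> t.
  have t1 : 1 < t by near: t; exact: nbhs_pinfty_gt.
  have [s /andP[s1 _]|s /andP[s1 _] e] := @mean_value R y dy 1 t t1.
    by apply: y_deriv; lra.
  rewrite -subr_ge0 e mulr_ge0 ?subr_ge0 ?ltW// dy_gt0//; lra.
have f_ge F : \forall t \near +oo, F - f t <= 0.
  apply: (@eventually_nonpositive R (fun t => F - f t) (fun t => - y t) c) => //.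
  near=> t; have t0 : 0 < t by near: t.
  split; last by move=> _; rewrite lerN2; near: t.
  by have ? := f_deriv _ t0; apply: is_derive_eq; rewrite /GRing.scale/=; ring.
(* Where [xi + y >= K], the quadratic term of [riccati] makes [xi' <= - 1]. *)
pose K := m * (eps / 2 + 1) + 1.
have K_ge1 : 1 <= K.
  by rewrite lerDr mulr_ge0 //; lra.
have K_sq (z : R) : K <= z -> eps / 2 + 1 <= z ^+ 2 / m.
  by move=> Kz; rewrite ler_pdivlMr//; rewrite /K in Kz K_ge1; nra.
have xi_le : \forall t \near +oo, xi t - K <= 0.
  apply: (@eventually_nonpositive R (fun t => xi t - K) dxi 1) => //.
  near=> t; have t0 : 0 < t by near: t.
  split.
    by have ? := xi_deriv _ t0; apply: is_derive_eq; rewrite /GRing.scale/=; ring.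
  move=> xiK; have := riccati _ t0; have := K_sq (xi t + y t); have := y_gt0 _ t0.
  lra.
have y_ge_any Y : \forall t \near +oo, Y - y t <= 0.
  apply: (@eventually_nonpositive R (fun t => Y - y t) (fun t => - dy t) 1) => //.
  near=> t; have t0 : 0 < t by near: t.
  split.
    by have ? := y_deriv _ t0; apply: is_derive_eq; rewrite /GRing.scale/=; ring.
  move=> yY; rewrite conservation//.
  have : xi t * y t <= K * Y.
    have : xi t - K <= 0 by near: t.
    have := y_gt0 _ t0; nra.
  have : (K * Y + 1 - C) / eps - f t <= 0 by near: t.
  by rewrite subr_le0 ler_pdivrMr//; lra.
have xi_le0 : \forall t \near +oo, xi t <= 0.
  apply: (@eventually_nonpositive R xi dxi 1) => //.
  near=> t; have t0 : 0 < t by near: t.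
  split; first exact: xi_deriv.
  move=> xi0; have := riccati _ t0; have := K_sq (xi t + y t).
  have : K - y t <= 0 by near: t.
  lra.
(* [sigma = y'/y + xi = (eps f + C) / y] satisfies [sigma' <= eps - sigma ^ 2]
   once [xi <= 0], so that [eps + 1] eventually bounds it; this is stated
   multiplied by [y]. *)
pose s := eps + 1.
have drift_le : \forall t \near +oo, eps * f t + C - s * y t <= 0.
  apply: (@eventually_nonpositive R (fun t => eps * f t + C - s * y t)
    (fun t => eps * y t - s * dy t) c) => //.
  near=> t; have t0 : 0 < t by near: t.
  have yc : c <= y t by near: t.
  have xit : xi t <= 0 by near: t.
  split.
    have ? := y_deriv _ t0; have ? := f_deriv _ t0; apply: is_derive_eq.
    by rewrite /GRing.scale/=; ring.
  move=> G0; rewrite conservation//; rewrite /s in G0 *.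
  have yt0 := y_gt0 _ t0.
  have h1 : 0 <= (eps + 1) * (- xi t * y t) by rewrite !mulr_ge0 ?oppr_ge0//; lra.
  have h2 : 0 <= (eps + 1) * (eps * f t + C - (eps + 1) * y t) by rewrite mulr_ge0//; lra.
  have h3 : 0 <= eps * eps * y t by rewrite !mulr_ge0 ?ltW.
  have h4 : 0 <= eps * y t by rewrite !mulr_ge0 ?ltW.
  lra.
(* Where [- a y < xi <= 0], the Riccati term is at least
   [(3 / 4 y) ^ 2 / m], which exceeds [a ^ 2 y ^ 2 <= y ^ 2 / (16 m)]. *)
pose a := (4 * m)^-1.
have a_gt0 : 0 < a by rewrite invr_gt0 mulr_gt0.
have am : a * m = 4^-1 by rewrite /a; field; lra.
have barrier_le : \forall t \near +oo, xi t + a * y t <= 0.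
  apply: (@eventually_nonpositive R (fun t => xi t + a * y t)
    (fun t => dxi t + a * dy t) 1) => //.
  near=> t; have t0 : 0 < t by near: t.
  have xit : xi t <= 0 by near: t.
  have drt : eps * f t + C - s * y t <= 0 by near: t.
  have yt : s + 4 * K - y t <= 0 by near: t.
  split.
    have ? := y_deriv _ t0; have ? := xi_deriv _ t0.
    by apply: is_derive_eq; rewrite /GRing.scale/=; ring.
  move=> w0; apply: (le_trans (lerD (riccati _ t0) (lexx _))); rewrite conservation//.
  rewrite -(ler_pM2r m_gt0) mulrDl mulrBl divfK ?gt_eqF// [X in _ + X]mulrAC am.
  rewrite /s in drt yt; rewrite /K in yt.
  have a4 : a <= 4^-1 by rewrite -am ler_peMr// ltW.
  have yt0 := y_gt0 _ t0.
  have h1 : (3 / 4 * y t) ^+ 2 <= (xi t + y t) ^+ 2 by rewrite ler_sqr ?nnegrE; nra.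
  have h2 : - xi t * y t <= 4^-1 * y t ^+ 2 by nra.
  nra.
(* From here on [y' >= a y ^ 2]. *)
suff /filter_ex[t [t0 /=]] : \forall t \near +oo, 0 < t /\ (y t)^-1 <= 0.
  by rewrite leNgt invr_gt0 y_gt0.
near=> t; split; first by near: t.
near: t.
apply: (@eventually_nonpositive R (fun t => (y t)^-1)
  (fun t => - (y t) ^- 2 * dy t) a) => //.
near=> t; have t0 : 0 < t by near: t.
have yt0 := y_gt0 _ t0.
split.
  have ? := y_deriv _ t0.
  apply: DeriveDef; first by apply: derivableV; [rewrite gt_eqF|].
  by rewrite deriveV ?gt_eqF// derive_val.
move=> _; rewrite mulNr lerN2 mulrC ler_pdivlMr ?exprn_gt0// conservation//.
have : xi t + a * y t <= 0 by near: t.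
have : - C / eps - f t <= 0 by near: t.
rewrite subr_le0 ler_pdivrMr//; nra.
Unshelve. all: by end_near. Qed.

Lemma is_derive_expMl {R : realType} (g : R -> R) (dg k t : R) :
  is_derive t 1 g dg ->
  is_derive t 1 (fun s => expR (k * s) * g s) (expR (k * t) * (dg + k * g t)).
Proof.
move=> gd.
apply: is_derive_eq; rewrite /GRing.scale/=; ring.
Qed.

(** Where the function is negative, multiplying it by a suitable exponential
    makes it nondecreasing; so a negative value would persist back to [0]. *)
Lemma nonneg_of_differential_inequality {R : realType} (g dg xi : R -> R) :
  (forall t : R, 0 < t -> is_derive (t : R) 1 g (dg t)) ->
  (forall t : R, 0 < t -> - xi t * g t <= dg t) ->
  (forall T : R, exists c, forall t, 0 < t <= T -> - c <= xi t) ->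
  g t @[t --> 0^'+] --> 0 ->
  forall t : R, 0 < t -> 0 <= g t.
Proof.
move=> gd dgge xige g0 T T0; rewrite leNgt; apply/negP => gT.
have [c xic] := xige T.
pose psi t := expR (- c * t) * g t.
have psid (t : R) : 0 < t ->
    is_derive t 1 psi (expR (- c * t) * (dg t + - c * g t)).
  by move=> t0; apply: is_derive_expMl; exact: gd.
have psiT : psi T < 0 by rewrite pmulr_rlt0 ?expR_gt0.
have psi0 : psi t @[t --> 0^'+] --> 0.
  rewrite -[X in _ --> X](mulr0 (expR (- c * 0))); apply: cvgM => //.
  apply: cvg_at_right_filter.
  have : is_derive (0 : R) 1 (fun t => expR (- c * t)) (expR (- c * 0) * - c).
    by apply: is_derive_eq; rewrite /GRing.scale/=; ring.
  by move/is_derive_continuous.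
have [a [a0 aT psia]] : exists a, [/\ 0 < a, a < T & psi T / 2 < psi a].
  have /filter_ex[a [[]]] : \forall a \near 0^'+, (0 < a /\ a < T) /\ psi T / 2 < psi a.
    near=> a; split; [split|]; near: a.
    - exact: nbhs_right_gt.
    - exact: nbhs_right_lt.
    - apply: (cvgr_gt 0 psi0); lra.
  by exists a.
have psicont s : 0 < s -> {for s, continuous (fun t => psi T / 2 - psi t)}.
  move=> s0; have := is_derive_continuous _ _ _ (psid s s0) => psic.
  by apply: continuousB => //; exact: cst_continuous.
have [s /andP[as_ _]|||s [/andP[as_ sT] hs hpos]] :=
    @last_nonpositive R (fun t => psi T / 2 - psi t) a T (ltW aT).
- by apply: psicont; lra.
- by lra.
- by lra.
have [t /andP[st _]|t /andP[st tT] e] := @mean_value R psi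
    (fun t => expR (- c * t) * (dg t + - c * g t)) s T sT.
  by apply: psid; lra.
have gt : g t < 0.
  have : 0 < psi T / 2 - psi t by apply: hpos; rewrite st ltW.
  move=> h; rewrite -(pmulr_rlt0 _ (expR_gt0 (- c * t))) -/(psi t); lra.
have : 0 <= dg t + - c * g t.
  have t0 : 0 < t by lra.
  have := dgge _ t0; have : - c <= xi t by apply: xic; rewrite t0 ltW.
  nra.
rewrite -(pmulr_rge0 _ (expR_gt0 (- c * t))) => d0.
have : 0 <= psi T - psi s by rewrite e mulr_ge0// subr_ge0 ltW.
lra.
Unshelve. all: by end_near. Qed.

(** Uniqueness for a linear first order system, by Gronwall's argument for
    the energy [phi ^+ 2 + y ^+ 2]. *)
Lemma linear_system_uniqueness {R : realType} (k c : R) (phi y xi : R -> R)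
    (a b : R) :
  0 < k -> a < b ->
  (forall t : R, a <= t <= b -> is_derive (t : R) 1 phi (y t)) ->
  (forall t : R, a <= t <= b -> is_derive (t : R) 1 y (k * phi t - xi t * y t)) ->
  (forall t : R, a <= t <= b -> - c <= xi t) ->
  phi a = 0 -> y a = 0 -> y b = 0.
Proof.
move=> k0 ab phid yd xic phia ya.
(* A growth rate of the energy: [2 (1 + k) phi y <= (1 + k) E] and
   [- 2 xi y ^ 2 <= 2 |c| E]. *)
pose K := 1 + k + 2 * `|c|.
pose E t := phi t ^+ 2 + y t ^+ 2.
pose dE t := 2 * (1 + k) * (phi t * y t) - 2 * xi t * y t ^+ 2.
have Ed t : a <= t <= b -> is_derive (t : R) 1 (fun s => expR (- K * s) * E s)
     (expR (- K * t) * (dE t + - K * E t)).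
  move=> t_ab; apply: is_derive_expMl; have ? := yd t t_ab; have ? := phid t t_ab.
  rewrite /E /dE; apply: is_derive_eq; rewrite /GRing.scale/=; ring.
have [t /andP[at_ tb] e] := @mean_value R _ _ a b ab Ed.
have tab : a <= t <= b by rewrite !ltW.
have : dE t + - K * E t <= 0.
  rewrite /dE /E /K.
  have h1 : - (xi t) * y t ^+ 2 <= `|c| * y t ^+ 2.
    by apply: ler_wpM2r; rewrite ?sqr_ge0//; have := xic t tab; have := ler_norm c; lra.
  have h2 : 0 <= (1 + k) * (phi t - y t) ^+ 2 by rewrite mulr_ge0 ?sqr_ge0//; lra.
  have h3 : 0 <= `|c| * phi t ^+ 2 by rewrite mulr_ge0 ?sqr_ge0.
  nra.
rewrite -(pmulr_rle0 _ (expR_gt0 (- K * t))) => d0.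
have : expR (- K * b) * E b <= 0.
  have -> : expR (- K * b) * E b = expR (- K * b) * E b - expR (- K * a) * E a.
    by rewrite /E phia ya expr0n/= addr0 mulr0 subr0.
  by rewrite e mulr_le0_ge0// subr_ge0 ltW.
rewrite pmulr_rle0 ?expR_gt0// /E => Eb.
by apply/eqP; rewrite -sqrf_eq0 eq_le sqr_ge0 andbT; have := sqr_ge0 (phi b); lra.
Qed.

Lemma constant_of_derive0 {R : realType} (g : R -> R) :
  (forall t : R, 0 < t -> is_derive (t : R) 1 g 0) ->
  forall s t : R, 0 < s -> 0 < t -> g s = g t.
Proof.
move=> gd; suff h (s t : R) : 0 < s -> s < t -> g s = g t.
  by move=> s t s0 t0; have [st|ts|->//] := ltgtP s t; [exact: h|exact/esym/h].
move=> s0 st; have [r|r _ e] := @mean_value R g (fun=> 0) s t st.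
  by case/andP => sr _; apply: gd; exact: lt_le_trans sr.
by apply/eqP; rewrite eq_sym -subr_eq0 e mul0r.
Qed.

Lemma nonvanishing_same_sign {R : realType} (g : R -> R) :
  (forall t : R, 0 < t -> {for t, continuous g}) ->
  (forall t : R, 0 < t -> g t != 0) ->
  forall s t : R, 0 < s -> 0 < t -> 0 < g s * g t.
Proof.
move=> gc g_neq0; suff h (s t : R) : 0 < s -> s <= t -> 0 < g s * g t.
  move=> s t s0 t0; have [st|ts] := leP s t; first exact: h.
  by rewrite mulrC; apply: h => //; exact: ltW.
move=> s0 st; rewrite ltNge; apply/negP => gst.
have t0 : 0 < t by exact: lt_le_trans st.
have [||r] := @IVT R g s t 0 st.
- apply: continuous_in_subspaceT => r; rewrite inE/= in_itv/= => /andP[sr _].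
  by apply: gc; exact: lt_le_trans sr.
- rewrite ge_min le_max.
  have [gs|gs|gs] := ltgtP (g s) 0; last by move: (g_neq0 s s0); rewrite gs eqxx.
  + by move: gst; rewrite nmulr_rle0// => ->.
  + by move: gst; rewrite pmulr_rle0// => ->.
- rewrite in_itv/= => /andP[sr _] gr.
  by have := g_neq0 r (lt_le_trans s0 sr); rewrite gr eqxx.
Qed.

(** The third case [0 < y], [0 < dy] is excluded by
    [no_increasing_solution].  The sign of [y * dy] propagates from its limit
    at [0]. *)
Lemma soliton_ode_dichotomy {R : realType} (eps m : R)
    (f y dy ddy H dH q : R -> R) :
  0 < eps -> 1 <= m ->
  (forall t : R, 0 < t -> is_derive (t : R) 1 f (y t)) ->
  (forall t : R, 0 < t -> is_derive (t : R) 1 y (dy t)) ->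
  (forall t : R, 0 < t -> is_derive (t : R) 1 dy (ddy t)) ->
  (forall t : R, 0 < t -> is_derive (t : R) 1 H (dH t)) ->
  (forall t : R, 0 < t -> dH t = - q t + dy t + eps / 2) ->
  (forall t : R, 0 < t ->
    ddy t + (H t - y t) * dy t = (q t + eps / 2) * y t) ->
  (forall t : R, 0 < t -> H t ^+ 2 <= m * q t) ->
  (y t * dy t) @[t --> 0^'+] --> 0 ->
  (forall t : R, 0 < t -> y t = 0) \/ (forall t : R, 0 < t -> y t < 0 /\ dy t < 0).
Proof.
move=> eps0 m1 fd yd dyd Hd dHE ddyE Hq Phi0.
have m0 : 0 < m by lra.
pose xi t := H t - y t.
have q0 (t : R) : 0 < t -> 0 <= q t.
  move=> t0; rewrite -(pmulr_rge0 _ m0).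
  by apply: le_trans (Hq t t0); exact: sqr_ge0.
have xid (t : R) : 0 < t -> is_derive (t : R) 1 xi (- q t + eps / 2).
  move=> t0; have ? := Hd t t0; have ? := yd t t0.
  by apply: is_derive_eq; rewrite dHE//; ring.
have xi_ge (T : R) : exists c, forall t : R, 0 < t <= T -> - c <= xi t.
  exists (eps / 2 * T - xi T) => t /andP[t0]; rewrite le_eqVlt => /predU1P[tT|tT].
    rewrite tT in t0 *.
    have : 0 <= eps / 2 * T.
      by apply: mulr_ge0; lra.
    by lra.
  have [r|r /andP[tr rT] e] := @mean_value R xi (fun t => - q t + eps / 2) t T tT.
    by case/andP => tr _; apply: xid; exact: lt_le_trans tr.
  have := q0 r (lt_trans t0 tr).
  nra.
pose C := dy 1 + xi 1 * y 1 - eps * f 1.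
have dyE (t : R) : 0 < t -> dy t = eps * f t + C - xi t * y t.
  move=> t0; suff : dy t + xi t * y t - eps * f t = C by move=> <-; ring.
  pose c s := dy s + xi s * y s - eps * f s.
  apply: (@constant_of_derive0 R c) => // s s0.
  have ? := dyd s s0; have ? := xid s s0; have ? := yd s s0; have ? := fd s s0.
  apply: is_derive_eq; rewrite /GRing.scale/= /xi.
  have := ddyE s s0; lra.
pose Phi t := y t * dy t.
pose dPhi t := dy t ^+ 2 + y t * ddy t.
have Phid (t : R) : 0 < t -> is_derive (t : R) 1 Phi (dPhi t).
  move=> t0; have ? := dyd t t0; have ? := yd t t0.
  by apply: is_derive_eq; rewrite /GRing.scale/= /dPhi; ring.
have dPhiE (t : R) : 0 < t ->
    dPhi t = dy t ^+ 2 + (q t + eps / 2) * y t ^+ 2 - xi t * Phi t.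
  by move=> t0; rewrite /dPhi /Phi expr2 (expr2 (y t)) mulrA -ddyE// /xi; ring.
have Phi_ge0 : forall t : R, 0 < t -> 0 <= Phi t.
  apply: (@nonneg_of_differential_inequality R Phi dPhi xi) => // t t0.
  rewrite dPhiE// mulNr lerDr addr_ge0 ?sqr_ge0// mulr_ge0 ?sqr_ge0//.
  by have := q0 t t0; lra.
have y_mono (s t : R) : 0 < s -> s < t -> y s ^+ 2 <= y t ^+ 2.
  move=> s0 st.
  have [r /andP[sr _]|r /andP[sr _] e] :=
      @mean_value R (fun r => y r ^+ 2) (fun r => 2 * Phi r) s t st.
    have ? := yd r (lt_le_trans s0 sr).
    by apply: is_derive_eq; rewrite /GRing.scale/= /Phi; ring.
  have := Phi_ge0 r (lt_trans s0 sr) => ?.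
  rewrite -subr_ge0 e; apply: mulr_ge0; last by rewrite subr_ge0 ltW.
  exact: mulr_ge0.
have [|/existsNP[t1 /not_implyP[t10 /eqP yt1]]] :=
    pselect (forall t : R, 0 < t -> y t = 0); first by left.
(* By monotonicity of [y ^ 2], a zero of [y] is the end of an interval where
   [y = 0]; there [f + C / eps] vanishes too, by the conservation law. *)
have y_neq0 (t0 : R) : 0 < t0 -> y t0 != 0.
  move=> t00; apply/negP => /eqP yt0.
  have t01 : t0 < t1.
    rewrite ltNge le_eqVlt; apply/negP => /predU1P[e|t10'].
      by move: yt1; rewrite e yt0 eqxx.
    have := y_mono t1 t0 t10 t10'; rewrite yt0 expr0n/= => h.
    by move: yt1; rewrite -sqrf_eq0 eq_le h sqr_ge0.
  have y0 (t : R) : 0 < t <= t0 -> y t = 0.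
    move=> /andP[tp]; rewrite le_eqVlt => /predU1P[->//|tt0].
    have := y_mono t t0 tp tt0; rewrite yt0 expr0n/= => h.
    by apply/eqP; rewrite -sqrf_eq0 eq_le h sqr_ge0.
  have t02 : t0 / 2 < t0 by lra.
  have [t /andP[h _]|a /andP[a1 a2]] := @mean_value R y dy _ _ t02.
    by apply: yd; lra.
  have a0 : 0 < a by lra.
  have ya : y a = 0 by apply: y0; rewrite a0 ltW.
  rewrite !y0 ?subrr; [|lra..] => /eqP.
  rewrite eq_sym mulf_eq0 => /orP[/eqP dya|]; last by rewrite subr_eq0 gt_eqF.
  have [c xic] := xi_ge t1.
  move/negP: yt1; apply; apply/eqP.
  apply: (@linear_system_uniqueness R eps c (fun t => f t + C / eps) y xi a t1) => //.
  - exact: lt_trans a2 t01.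
  - move=> t /andP[at_ _]; have ? := fd t (lt_le_trans a0 at_).
    by apply: is_derive_eq; ring.
  - move=> t /andP[at_ _]; have t0' := lt_le_trans a0 at_.
    have := yd t t0'; rewrite dyE//.
    by have -> : eps * (f t + C / eps) = eps * f t + C by field; rewrite gt_eqF.
  - by move=> t /andP[at_ tt1]; apply: xic; rewrite (lt_le_trans a0 at_).
  - have := dyE a a0; rewrite dya ya mulr0 subr0 => /esym/eqP.
    rewrite addr_eq0 => /eqP epsf; apply: (mulfI (lt0r_neq0 eps0)).
    by rewrite mulrDr epsf mulrCA divff ?gt_eqF// mulr1 addNr mulr0.
(* A zero of [Phi] would be a minimum, but [dPhi > 0] there. *)
have Phi_gt0 (t : R) : 0 < t -> 0 < Phi t.
  move=> t0; rewrite lt_neqAle Phi_ge0// andbT eq_sym; apply/negP => /eqP Pt.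
  have [||||_ e] := @derive1_at_min R Phi (t / 2) (t * 2) t.
  - lra.
  - move=> s; rewrite in_itv/= => /andP[s1 _].
    have s0 : 0 < s by lra.
    exact: (@ex_derive _ _ _ _ _ _ _ (Phid s s0)).
  - by rewrite in_itv/=; apply/andP; split; lra.
  - by move=> s; rewrite in_itv/= => /andP[s1 _]; rewrite Pt; apply: Phi_ge0; lra.
  move: e; rewrite (@derive_val _ _ _ _ _ _ _ (Phid t t0)) dPhiE// Pt mulr0 subr0.
  have y2 : 0 < y t ^+ 2 by rewrite exprn_even_gt0//= y_neq0.
  have := q0 t t0; have := sqr_ge0 (dy t) => h1 h2 h3.
  have : 0 < (q t + eps / 2) * y t ^+ 2 by rewrite mulr_gt0//; lra.
  lra.
have y_cont (t : R) : 0 < t -> {for t, continuous y}.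
  by move=> t0; exact: is_derive_continuous (yd t t0).
have y_sign := @nonvanishing_same_sign R y y_cont y_neq0.
have [y1|y1|y1] := ltgtP (y 1) 0; last by have := y_neq0 1 ltr01; rewrite y1 eqxx.
- right => t t0; have yt : y t < 0 by have := y_sign 1 t ltr01 t0; rewrite nmulr_rgt0.
  by split => //; have := Phi_gt0 t t0; rewrite nmulr_rgt0.
- have ypos (t : R) : 0 < t -> 0 < y t.
    by move=> t0; have := y_sign 1 t ltr01 t0; rewrite pmulr_rgt0.
  exfalso; apply: (@no_increasing_solution R eps C m f y dy xi
    (fun t => - q t + eps / 2)) => // [t t0|t t0].
    by rewrite addrC lerD2l lerN2 ler_pdivrMr// mulrC subrK Hq.
  by split; [exact: ypos|have := Phi_gt0 t t0; rewrite pmulr_rgt0// ypos].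
Qed.

Set Implicit Arguments.
Unset Strict Implicit.

(** * Smooth functions on open sets *)

Lemma is_derive_line {R : realType} {m : nat} (f : 'rV[R]_m -> R)
    (x v : 'rV[R]_m) (s : R) : derivable f (x + s *: v) v ->
  is_derive s 1 (fun r => f (x + r *: v)) ('D_v f (x + s *: v)).
Proof.
have e : (fun h : R => h^-1 *: (f (x + (h *: (1 : R) + s) *: v) - f (x + s *: v)))
    = (fun h : R => h^-1 *: (f (h *: v + (x + s *: v)) - f (x + s *: v))).
  by apply/funext => h; rewrite [h *: (1 : R)]mulr1 scalerDl addrCA.
by move=> fd; apply: DeriveDef; rewrite /derivable /derive /= e.
Qed.

Section SmoothFunctions.
Context {R : realType} {m : nat}.
Implicit Types (f g : 'rV[R]_m -> R) (O : set 'rV[R]_m) (x : 'rV[R]_m).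

(** Finite orders of differentiability make the closure properties below
    provable by induction: a partial derivative of a product or of an inverse
    is a sum of products of functions that are smooth to the order below. *)
Definition smooth_upto (k : nat) O f := forall (s : seq 'I_m) x,
  (size s <= k)%N -> O x ->
  {for x, continuous (foldr partial f s)} /\
  forall i, derivable (foldr partial f s) x (delta_mx 0 i).

Lemma smooth_uptoP O f : smooth_on O f <-> forall k, smooth_upto k O f.
Proof.
split=> [fs k s x _ | fs s x]; first exact: fs.
by apply: (fs (size s)).
Qed.

Lemma smooth_uptoSP k O f : smooth_upto k.+1 O f <->
  smooth_upto 0 O f /\ forall i, smooth_upto k O (partial i f).
Proof.
split=> [fs|[f0 fS] s x].
  split=> [s x s0 | i s x sk]; first by apply: fs; exact: leq_trans s0 _.
  by rewrite -foldr_rcons; apply: fs; rewrite size_rcons.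
case: (lastP s) => [_|{}s i]; first exact: (f0 [::]).
by rewrite size_rcons foldr_rcons; exact: fS.
Qed.

Lemma smooth_uptoW k O f : smooth_upto k.+1 O f -> smooth_upto k O f.
Proof. by move=> fs s x sk; apply: fs; exact: leqW. Qed.

Lemma open_near O x (P : 'rV[R]_m -> Prop) : open O -> O x ->
  (forall y, O y -> P y) -> \forall y \near x, P y.
Proof. by move=> Oo Ox OP; apply: filterS OP (open_nbhs_nbhs (conj Oo Ox)). Qed.

Lemma partial_eq O f g i x : open O -> O x -> (forall y, O y -> f y = g y) ->
  partial i f x = partial i g x.
Proof. by move=> Oo Ox fg; apply: near_eq_derive; exact: open_near fg. Qed.

Lemma smooth_upto_eq k O f g : open O -> (forall x, O x -> f x = g x) ->
  smooth_upto k O f -> smooth_upto k O g.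
Proof.
move=> Oo fg fs s x sk Ox.
have {}fg y : O y -> foldr partial f s y = foldr partial g s y.
  by elim: s {sk} y => [|i s IH] y Oy; [exact: fg|exact: (partial_eq i Oo Oy IH)].
have [fc fd] := fs s x sk Ox.
have near_fg : \forall y \near x, foldr partial f s y = foldr partial g s y.
  exact: open_near fg.
split=> [|i]; last exact: near_eq_derivable (fd i).
change (foldr partial g s y @[y --> x] --> foldr partial g s x).
rewrite -(fg x Ox); apply: cvg_trans fc.
apply: (@near_eq_cvg _ _ (nbhs x)); apply: filterS near_fg => y ->; exact: erefl.
Qed.

Lemma smooth_upto0 O f :
  (forall x, O x -> {for x, continuous f} /\
    forall i, derivable f x (delta_mx 0 i)) -> smooth_upto 0 O f.
Proof. by move=> fs [|//] x _; exact: fs. Qed.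

Lemma smooth_on_eq O f g : open O -> (forall x, O x -> f x = g x) ->
  smooth_on O f -> smooth_on O g.
Proof.
by move=> Oo fg /smooth_uptoP fs; apply/smooth_uptoP => k; exact: smooth_upto_eq fg _.
Qed.

Lemma smooth_on_continuous O f x : smooth_on O f -> O x -> {for x, continuous f}.
Proof. by move=> fs /(fs [::])[]. Qed.

Lemma smooth_on_derivable O f x i : smooth_on O f -> O x ->
  derivable f x (delta_mx 0 i).
Proof. by move=> fs /(fs [::])[]. Qed.

Lemma smooth_on_partial O f i : smooth_on O f -> smooth_on O (partial i f).
Proof. by move=> fs s x; rewrite -foldr_rcons; exact: fs. Qed.

Lemma smooth_on_cst O (c : R) : smooth_on O (fun=> c).
Proof.
apply/smooth_uptoP => k; elim: k c => [|k IH] c.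
  apply: smooth_upto0 => x _; split=> [|i]; first exact: cst_continuous.
  exact: derivable_cst.
apply/smooth_uptoSP; split=> [|i].
  by move=> s x s0; apply: (IH c); exact: leq_trans s0 _.
have -> : partial i (fun=> c) = fun=> 0 by apply/funext => x; exact: derive_cst.
exact: IH.
Qed.

Lemma smooth_uptoD k O f g : open O -> smooth_upto k O f -> smooth_upto k O g ->
  smooth_upto k O (fun x => f x + g x).
Proof.
move=> Oo; elim: k f g => [|k IH] f g fs gs.
  apply: smooth_upto0 => x Ox; have [fc fd] := fs [::] x isT Ox.
  have [gc gd] := gs [::] x isT Ox; split=> [|i]; first exact: continuousD.
  exact: derivableD.
move/smooth_uptoSP: fs (fs) => [f0 fS] /smooth_uptoW fk.
move/smooth_uptoSP: gs (gs) => [g0 gS] /smooth_uptoW gk.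
apply/smooth_uptoSP; split=> [s x s0|i].
  by apply: (IH f g) => //; exact: leq_trans s0 _.
apply: smooth_upto_eq (IH _ _ (fS i) (gS i)) => // x Ox.
have [_ fd] := f0 [::] x isT Ox; have [_ gd] := g0 [::] x isT Ox.
by rewrite /partial -deriveD.
Qed.

Lemma smooth_uptoM k O f g : open O -> smooth_upto k O f -> smooth_upto k O g ->
  smooth_upto k O (fun x => f x * g x).
Proof.
move=> Oo; elim: k f g => [|k IH] f g fs gs.
  apply: smooth_upto0 => x Ox; have [fc fd] := fs [::] x isT Ox.
  have [gc gd] := gs [::] x isT Ox; split=> [|i]; first exact: continuousM.
  exact: derivableM.
move/smooth_uptoSP: fs (fs) => [f0 fS] /smooth_uptoW fk.
move/smooth_uptoSP: gs (gs) => [g0 gS] /smooth_uptoW gk.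
apply/smooth_uptoSP; split=> [s x s0|i].
  by apply: (IH f g) => //; exact: leq_trans s0 _.
apply: smooth_upto_eq (smooth_uptoD Oo (IH _ _ fk (gS i)) (IH _ _ gk (fS i))) => // x Ox.
have [_ fd] := f0 [::] x isT Ox; have [_ gd] := g0 [::] x isT Ox.
by rewrite /partial deriveM.
Qed.

Lemma smooth_uptoV k O f : open O -> (forall x, O x -> f x != 0) ->
  smooth_upto k O f -> smooth_upto k O (fun x => (f x)^-1).
Proof.
move=> Oo f_neq0; elim: k => [|k IH] fs.
  apply: smooth_upto0 => x Ox; have [fc fd] := fs [::] x isT Ox.
  split=> [|i]; first exact: (continuousV (f_neq0 x Ox) fc).
  by apply: derivableV; [exact: f_neq0|exact: fd].
move/smooth_uptoSP: fs (fs) => [f0 fS] /smooth_uptoW /IH fk.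
apply/smooth_uptoSP; split=> [s x s0|i].
  by apply: fk => //; exact: leq_trans s0 _.
have ck : smooth_upto k O (fun=> -1) by apply: (smooth_uptoP O _).1; exact: smooth_on_cst.
apply: smooth_upto_eq
  (smooth_uptoM Oo ck (smooth_uptoM Oo (smooth_uptoM Oo fk fk) (fS i))) => // x Ox.
have [_ fd] := f0 [::] x isT Ox.
rewrite /partial deriveV ?f_neq0// /GRing.scale/= mulN1r -invfM -expr2 mulNr.
by [].
Qed.

Section Open.
Context {O : set 'rV[R]_m}.
Hypothesis Oo : open O.

Lemma smooth_onD f g : smooth_on O f -> smooth_on O g ->
  smooth_on O (fun x => f x + g x).
Proof.
move=> /smooth_uptoP fs /smooth_uptoP gs; apply/smooth_uptoP => k.
exact: smooth_uptoD.
Qed.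

Lemma smooth_onM f g : smooth_on O f -> smooth_on O g ->
  smooth_on O (fun x => f x * g x).
Proof.
move=> /smooth_uptoP fs /smooth_uptoP gs; apply/smooth_uptoP => k.
exact: smooth_uptoM.
Qed.

Lemma smooth_onV f : (forall x, O x -> f x != 0) -> smooth_on O f ->
  smooth_on O (fun x => (f x)^-1).
Proof.
move=> f_neq0 /smooth_uptoP fs; apply/smooth_uptoP => k; exact: smooth_uptoV.
Qed.

Lemma smooth_on_sum (I : Type) (r : seq I) (P : pred I) (F : I -> 'rV[R]_m -> R) :
  (forall i, P i -> smooth_on O (F i)) ->
  smooth_on O (fun x => \sum_(i <- r | P i) F i x).
Proof.
move=> Fs; elim: r => [|i r IH].
  by apply: (smooth_on_eq Oo _ (smooth_on_cst 0)) => x _; rewrite big_nil.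
case Pi: (P i).
  apply: (smooth_on_eq Oo _ (smooth_onD (Fs i Pi) IH)) => x _; by rewrite big_cons Pi.
by apply: (smooth_on_eq Oo _ IH) => x _; rewrite big_cons Pi.
Qed.

Lemma smooth_on_prod (I : Type) (r : seq I) (F : I -> 'rV[R]_m -> R) :
  (forall i, smooth_on O (F i)) -> smooth_on O (fun x => \prod_(i <- r) F i x).
Proof.
move=> Fs; elim: r => [|i r IH].
  apply: (smooth_on_eq Oo _ (smooth_on_cst 1)) => x _; by rewrite big_nil.
apply: (smooth_on_eq Oo _ (smooth_onM (Fs i) IH)) => x _; by rewrite big_cons.
Qed.

Lemma partialD f g i x : smooth_on O f -> smooth_on O g -> O x ->
  partial i (fun y => f y + g y) x = partial i f x + partial i g x.
Proof.
by move=> fs gs Ox; apply: deriveD;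
  [exact: smooth_on_derivable fs Ox|exact: smooth_on_derivable gs Ox].
Qed.

Lemma partialM f g i x : smooth_on O f -> smooth_on O g -> O x ->
  partial i (fun y => f y * g y) x = partial i f x * g x + f x * partial i g x.
Proof.
move=> fs gs Ox; have fd := smooth_on_derivable (i := i) fs Ox.
have gd := smooth_on_derivable (i := i) gs Ox.
apply: etrans (deriveM fd gd) _.
by rewrite addrC [g x *: _]mulrC.
Qed.

Lemma partial_cst (c : R) i x : partial i (fun=> c) x = 0.
Proof. exact: derive_cst. Qed.

Lemma partial_sum (I : Type) (r : seq I) (F : I -> 'rV[R]_m -> R) i x :
  (forall j, smooth_on O (F j)) -> O x ->
  partial i (fun y => \sum_(j <- r) F j y) x = \sum_(j <- r) partial i (F j) x.
Proof.
move=> Fs Ox; elim: r => [|j r IH].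
  rewrite big_nil -[RHS](partial_cst 0 i x).
  by apply: (partial_eq i Oo Ox) => y _; rewrite big_nil.
rewrite big_cons -IH -partialD//; last by apply: smooth_on_sum => k _; exact: Fs.
by apply: (partial_eq i Oo Ox) => y _; rewrite big_cons.
Qed.

(** Two applications of the mean value theorem, first along [e_i] and then
    along [e_j]. *)
Lemma second_difference f (i j : 'I_m) x e : 0 < e ->
  (forall y, `|y - x| < e -> O y) -> smooth_on O f ->
  forall h, 0 < h -> h * (`|delta_mx 0 i : 'rV[R]_m| + `|delta_mx 0 j : 'rV[R]_m|) < e ->
  exists2 y : 'rV[R]_m, `|y - x| < e &
    f (x + h *: delta_mx 0 i + h *: delta_mx 0 j) - f (x + h *: delta_mx 0 i)
    - (f (x + h *: delta_mx 0 j) - f x) = h ^+ 2 * partial j (partial i f) y.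
Proof.
move=> e0 xe fs h h0 he; set a := delta_mx 0 i; set b := delta_mx 0 j.
have near_x s r : 0 <= s <= h -> 0 <= r <= h -> `|x + s *: a + r *: b - x| < e.
  move=> /andP[s0 sh] /andP[r0 rh].
  have -> : x + s *: a + r *: b - x = s *: a + r *: b.
    by rewrite addrC -addrA addKr.
  apply: le_lt_trans he; apply: le_trans (ler_normD _ _) _.
  by rewrite !normrZ !ger0_norm// mulrDr lerD// ler_wpM2r.
have hh : 0 <= h <= h by rewrite lexx ltW.
have h00 : 0 <= (0 : R) <= h by rewrite lexx ltW.
pose g1 s := f (x + h *: b + s *: a).
pose g2 s := f (x + s *: a).
have [s sh|s /andP[s0 sh] gE] := @mean_value R (g1 - g2)
    (fun s => partial i f (x + h *: b + s *: a) - partial i f (x + s *: a)) 0 h h0.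
  have O1 : O (x + h *: b + s *: a).
    by apply: xe; rewrite (addrAC x (h *: b)); apply: near_x.
  have O2 : O (x + s *: a).
    by apply: xe; have := near_x s 0 sh h00; rewrite scale0r addr0.
  have d1 : is_derive s 1 g1 (partial i f (x + h *: b + s *: a)).
    exact: (is_derive_line (smooth_on_derivable fs O1)).
  have d2 : is_derive s 1 g2 (partial i f (x + s *: a)).
    exact: (is_derive_line (smooth_on_derivable fs O2)).
  exact: (@is_deriveB _ _ _ g1 g2).
have sh' : 0 <= s <= h by rewrite !ltW.
have [r rh|r /andP[r0 rh] dgE] := @mean_value R
    (fun r => partial i f (x + s *: a + r *: b))
    (fun r => partial j (partial i f) (x + s *: a + r *: b)) 0 h h0.
  have O1 : O (x + s *: a + r *: b) by apply: xe; exact: near_x.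
  exact: (is_derive_line (smooth_on_derivable (i := j) (smooth_on_partial i fs) O1)).
exists (x + s *: a + r *: b); first by apply: near_x => //; rewrite !ltW.
move: gE dgE; rewrite -[(g1 - g2) h]/(g1 h - g2 h) -[(g1 - g2) 0]/(g1 0 - g2 0).
rewrite /g1 /g2 !scale0r !addr0 !subr0 (addrAC x (h *: b) (s *: a)) => gE dgE.
by rewrite (addrAC x) gE dgE expr2 -mulrA mulrC.
Qed.

(** Schwarz's theorem: the second difference does not see the order of the
    two directions, and both mixed derivatives are continuous. *)
Lemma partialC f (i j : 'I_m) x : smooth_on O f -> O x ->
  partial i (partial j f) x = partial j (partial i f) x.
Proof.
move=> fs Ox; apply/eqP; rewrite -subr_eq0 -normr_le0; apply/ler_addgt0Pl => d d0.
have near_half k l : \forall y \near x,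
    `|partial k (partial l f) y - partial k (partial l f) x| < d / 2.
  have klc := smooth_on_continuous (smooth_on_partial k (smooth_on_partial l fs)) Ox.
  have d2 : 0 < d / 2 by lra.
  have {}klc : partial k (partial l f) y @[y --> x] --> partial k (partial l f) x := klc.
  exact: (cvgr_distC_lt _ _ klc _ d2).
have /nbhs_ballP[e /= e0 xe] : \forall y \near x, O y /\
    (`|partial i (partial j f) y - partial i (partial j f) x| < d / 2 /\
     `|partial j (partial i f) y - partial j (partial i f) x| < d / 2).
  apply: filterI; first by apply: open_nbhs_nbhs.
  by apply: filterI; exact: near_half.
have {}xe y : `|y - x| < e -> O y /\
    (`|partial i (partial j f) y - partial i (partial j f) x| < d / 2 /\
     `|partial j (partial i f) y - partial j (partial i f) x| < d / 2).
  by move=> yx; apply: xe; rewrite -ball_normE /= distrC.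
have xO y : `|y - x| < e -> O y by move=> /xe[].
pose c := `|delta_mx 0 i : 'rV[R]_m| + `|delta_mx 0 j : 'rV[R]_m| + 1.
have c0 : 0 < c by rewrite ltr_wpDl.
pose h := e / c.
have h0 : 0 < h by rewrite divr_gt0.
have hc : h * (`|delta_mx 0 i : 'rV[R]_m| + `|delta_mx 0 j : 'rV[R]_m|) < e.
  by rewrite /h mulrAC ltr_pdivrMr// ltr_pM2l// ltrDl.
have [y yx fij] := second_difference (i := i) (j := j) e0 xO fs h0 hc.
rewrite addrC in hc.
have [z zx fji] := second_difference (i := j) (j := i) e0 xO fs h0 hc.
have swap_x : x + h *: delta_mx 0 j + h *: delta_mx 0 i
    = x + h *: delta_mx 0 i + h *: delta_mx 0 j by exact: addrAC.
rewrite swap_x in fji.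
have [_ [_ yd]] := xe y yx; have [_ [zd _]] := xe z zx.
have yz : partial j (partial i f) y = partial i (partial j f) z.
  apply: (@mulfI _ (h ^+ 2)); first by rewrite expf_neq0 ?gt_eqF.
  have swap (a b c' d' : R) : a - b - (c' - d') = a - c' - (b - d') by ring.
  by apply: etrans (esym fij) (etrans _ fji); exact: swap.
move: yd zd; rewrite addr0 yz.
move: (partial i (partial j f) z) (partial i (partial j f) x) => w p.
move: (partial j (partial i f) x) => q yd zd.
apply: ltW; rewrite (splitr d); rewrite distrC in zd.
exact: le_lt_trans (ler_distD w _ _) (ltrD zd yd).
Qed.

End Open.
End SmoothFunctions.

(** * Matrix-valued functions *)

(** Locked, so that unification does not unfold derivatives to limits. *)
HB.lock Definition pmx {R : realType} {m p q : nat} (i : 'I_m)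
    (X : 'rV[R]_m -> 'M[R]_(p, q)) (x : 'rV[R]_m) : 'M[R]_(p, q) :=
  \matrix_(a, b) partial i (fun y => X y a b) x.

Section SmoothMatrices.
Context {R : realType} {m : nat} {O : set 'rV[R]_m}.
Hypothesis Oo : open O.

Definition smooth_mx {p q} (X : 'rV[R]_m -> 'M[R]_(p, q)) : Prop :=
  forall a b, smooth_on O (fun x => X x a b).

Lemma pmxE p q (X : 'rV[R]_m -> 'M[R]_(p, q)) i x a b :
  pmx i X x a b = partial i (fun y => X y a b) x.
Proof. by rewrite pmx.unlock mxE. Qed.

Lemma smooth_mx_eq p q (X Y : 'rV[R]_m -> 'M[R]_(p, q)) :
  (forall x, O x -> X x = Y x) -> smooth_mx X -> smooth_mx Y.
Proof.
by move=> XY Xs a b; apply: (smooth_on_eq Oo _ (Xs a b)) => x Ox; rewrite XY.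
Qed.

Lemma pmx_eq p q (X Y : 'rV[R]_m -> 'M[R]_(p, q)) i x : O x ->
  (forall y, O y -> X y = Y y) -> pmx i X x = pmx i Y x.
Proof.
move=> Ox XY; apply/matrixP => a b; rewrite !pmxE.
by apply: (partial_eq i Oo Ox) => y Oy; rewrite XY.
Qed.

Lemma smooth_pmx p q (X : 'rV[R]_m -> 'M[R]_(p, q)) i :
  smooth_mx X -> smooth_mx (pmx i X).
Proof.
move=> Xs a b; apply: (smooth_on_eq Oo _ (smooth_on_partial i (Xs a b))) => x _.
by rewrite pmxE.
Qed.

Lemma pmxC p q (X : 'rV[R]_m -> 'M[R]_(p, q)) i j x : smooth_mx X -> O x ->
  pmx i (pmx j X) x = pmx j (pmx i X) x.
Proof.
move=> Xs Ox; apply/matrixP => a b; rewrite [LHS]pmxE [RHS]pmxE.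
have e k : (fun y => pmx k X y a b) = partial k (fun y => X y a b).
  by apply/funext => y; exact: pmxE.
by rewrite (e i) (e j); exact: (partialC Oo i j (Xs a b) Ox).
Qed.

Lemma pmx_cst p q (c : 'M[R]_(p, q)) (i : 'I_m) (x : 'rV[R]_m) : pmx i (fun=> c) x = 0.
Proof. by apply/matrixP => a b; rewrite pmxE mxE partial_cst. Qed.

Lemma smooth_mxD p q (X Y : 'rV[R]_m -> 'M[R]_(p, q)) :
  smooth_mx X -> smooth_mx Y -> smooth_mx (fun x => X x + Y x).
Proof.
move=> Xs Ys a b; apply: (smooth_on_eq Oo _ (smooth_onD Oo (Xs a b) (Ys a b))).
by move=> x _; rewrite mxE.
Qed.

Lemma pmxD p q (X Y : 'rV[R]_m -> 'M[R]_(p, q)) i x :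
  smooth_mx X -> smooth_mx Y -> O x ->
  pmx i (fun y => X y + Y y) x = pmx i X x + pmx i Y x.
Proof.
move=> Xs Ys Ox; apply/matrixP => a b; rewrite [RHS]mxE !pmxE.
apply: etrans (partialD i (Xs a b) (Ys a b) Ox).
by congr partial; apply/funext => y; rewrite mxE.
Qed.

Lemma smooth_mxM p q r (X : 'rV[R]_m -> 'M[R]_(p, q)) (Y : 'rV[R]_m -> 'M[R]_(q, r)) :
  smooth_mx X -> smooth_mx Y -> smooth_mx (fun x => X x *m Y x).
Proof.
move=> Xs Ys a b.
have s : smooth_on O (fun x => \sum_j X x a j * Y x j b).
  by apply: (smooth_on_sum Oo) => j _; apply: (smooth_onM Oo).
by apply: (smooth_on_eq Oo _ s) => x _; rewrite mxE.
Qed.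

Lemma pmxM p q r (X : 'rV[R]_m -> 'M[R]_(p, q)) (Y : 'rV[R]_m -> 'M[R]_(q, r)) i x :
  smooth_mx X -> smooth_mx Y -> O x ->
  pmx i (fun y => X y *m Y y) x = pmx i X x *m Y x + X x *m pmx i Y x.
Proof.
move=> Xs Ys Ox; apply/matrixP => a b.
rewrite pmxE [RHS]mxE [X in X + _]mxE [X in _ + X]mxE.
transitivity (partial i (fun y => \sum_j X y a j * Y y j b) x).
  by congr partial; apply/funext => y; rewrite mxE.
have s j : smooth_on O (fun y => X y a j * Y y j b) by apply: (smooth_onM Oo).
rewrite (partial_sum Oo _ i s Ox) -big_split; apply: eq_bigr => j _.
by rewrite !pmxE; exact: (partialM i (Xs _ _) (Ys _ _) Ox).
Qed.

Lemma smooth_mxZ p q (X : 'rV[R]_m -> 'M[R]_(p, q)) (c : R) :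
  smooth_mx X -> smooth_mx (fun x => c *: X x).
Proof.
move=> Xs a b; have s := smooth_onM Oo (smooth_on_cst c) (Xs a b).
by apply: (smooth_on_eq Oo _ s) => x _; rewrite mxE.
Qed.

Lemma pmxZ p q (X : 'rV[R]_m -> 'M[R]_(p, q)) (c : R) i x :
  smooth_mx X -> O x -> pmx i (fun y => c *: X y) x = c *: pmx i X x.
Proof.
move=> Xs Ox; apply/matrixP => a b; rewrite [RHS]mxE !pmxE.
transitivity (partial i (fun y => c * X y a b) x).
  by congr partial; apply/funext => y; rewrite mxE.
apply: etrans (partialM i (smooth_on_cst c) (Xs a b) Ox) _.
by rewrite partial_cst mul0r add0r.
Qed.

Lemma smooth_mxN p q (X : 'rV[R]_m -> 'M[R]_(p, q)) :
  smooth_mx X -> smooth_mx (fun x => - X x).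
Proof. by move=> /(smooth_mxZ (-1)); apply: smooth_mx_eq => x _; rewrite scaleN1r. Qed.

Lemma pmxN p q (X : 'rV[R]_m -> 'M[R]_(p, q)) i x :
  smooth_mx X -> O x -> pmx i (fun y => - X y) x = - pmx i X x.
Proof.
move=> Xs Ox; rewrite -scaleN1r -pmxZ//; congr (pmx i _ x).
by apply/funext => y; rewrite scaleN1r.
Qed.

Lemma smooth_mx_tr p q (X : 'rV[R]_m -> 'M[R]_(p, q)) :
  smooth_mx X -> smooth_mx (fun x => (X x)^T).
Proof. by move=> Xs a b; apply: (smooth_on_eq Oo _ (Xs b a)) => x _; rewrite mxE. Qed.

Lemma pmx_tr p q (X : 'rV[R]_m -> 'M[R]_(p, q)) i x :
  pmx i (fun y => (X y)^T) x = (pmx i X x)^T.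
Proof.
apply/matrixP => a b; rewrite [RHS]mxE !pmxE.
by congr partial; apply/funext => y; rewrite mxE.
Qed.

Lemma smooth_mxtrace p (X : 'rV[R]_m -> 'M[R]_p) :
  smooth_mx X -> smooth_on O (fun x => \tr (X x)).
Proof. by move=> Xs; apply: (smooth_on_sum Oo) => j _; exact: Xs. Qed.

Lemma partial_mxtrace p (X : 'rV[R]_m -> 'M[R]_p) i x : smooth_mx X -> O x ->
  partial i (fun y => \tr (X y)) x = \tr (pmx i X x).
Proof.
move=> Xs Ox; apply: etrans (partial_sum Oo _ i (fun j => Xs j j) Ox) _.
by apply: eq_bigr => j _; rewrite pmxE.
Qed.

Lemma smooth_det p (X : 'rV[R]_m -> 'M[R]_p) :
  smooth_mx X -> smooth_on O (fun x => \det (X x)).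
Proof.
move=> Xs; apply: (smooth_on_sum Oo) => s _; apply: (smooth_onM Oo).
  exact: smooth_on_cst.
by apply: (smooth_on_prod Oo) => i; exact: Xs.
Qed.

Lemma smooth_invmx p (X : 'rV[R]_m -> 'M[R]_p) :
  (forall x, O x -> X x \in unitmx) -> smooth_mx X ->
  smooth_mx (fun x => invmx (X x)).
Proof.
move=> Xu Xs a b.
have s : smooth_on O (fun x => (\det (X x))^-1 * cofactor (X x) b a).
  apply: (smooth_onM Oo).
    apply: (smooth_onV Oo); last exact: smooth_det.
    by move=> x Ox; have := Xu x Ox; rewrite unitmxE unitfE.
  apply: (smooth_onM Oo); first exact: smooth_on_cst.
  apply: smooth_det => i j.
  by apply: (smooth_on_eq Oo _ (Xs (lift b i) (lift a j))) => x _; rewrite !mxE.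
by apply: (smooth_on_eq Oo _ s) => x Ox; rewrite /invmx Xu// !mxE.
Qed.

Lemma pmx_invmx p (X : 'rV[R]_m -> 'M[R]_p) i x :
  (forall y, O y -> X y \in unitmx) -> smooth_mx X -> O x ->
  pmx i (fun y => invmx (X y)) x = - (invmx (X x) *m pmx i X x *m invmx (X x)).
Proof.
move=> Xu Xs Ox; have Ps := smooth_invmx Xu Xs.
have : pmx i (fun y => invmx (X y) *m X y) x = 0.
  by rewrite -(pmx_cst 1%:M i x); apply: pmx_eq => // y Oy; rewrite mulVmx ?Xu.
rewrite pmxM// => /(congr1 (fun Y => Y *m invmx (X x))).
rewrite mul0mx mulmxDl -(mulmxA _ (X x)) mulmxV ?Xu// mulmx1 => /eqP.
by rewrite addr_eq0 => /eqP.
Qed.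

End SmoothMatrices.
Arguments smooth_mx {R m} O {p q} X.

(** * Metrics depending on a parameter *)

(** A matrix [h] of functions on an open set of [R^m] is viewed as a metric in
    the coordinates of index [sp i], which depends on the remaining
    coordinates as parameters; [tt] is the index of one of them, the time. *)
Section Definitions.
Context {R : realType} {m n : nat}.
Variables (sp : 'I_n -> 'I_m) (h : 'rV[R]_m -> 'M[R]_n).

Definition cometric x := invmx (h x).

(** Twice the Christoffel symbol of the first kind, [2 Gamma_{r, ij}]. *)
Definition first_kind i x : 'M[R]_n :=
  \matrix_(r, j) (pmx (sp i) h x r j + pmx (sp j) h x r i - pmx (sp r) h x i j).

End Definitions.

(** The entry [(l, j)] of the [i]-th matrix is [Gamma^l_ij]: it is the matrix
    of the connection form evaluated on [d_i], so that covariant derivatives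
    become matrix products and commutators. *)
HB.lock Definition levi_civita {R : realType} {m n : nat} (sp : 'I_n -> 'I_m)
    (h : 'rV[R]_m -> 'M[R]_n) (i : 'I_n) (x : 'rV[R]_m) : 'M[R]_n :=
  2^-1 *: (cometric h x *m first_kind sp h i x).

(** The endomorphism [L] with [dh/dt = 2 h L]. *)
HB.lock Definition weingarten {R : realType} {m n : nat} (tt : 'I_m)
    (h : 'rV[R]_m -> 'M[R]_n) (x : 'rV[R]_m) : 'M[R]_n :=
  2^-1 *: (cometric h x *m pmx tt h x).

Section EvolvingMetric.
Context {R : realType} {m n : nat} {O : set 'rV[R]_m}.
Hypothesis Oo : open O.
Variables (sp : 'I_n -> 'I_m) (tt : 'I_m) (h : 'rV[R]_m -> 'M[R]_n).
Hypothesis hs : smooth_mx O h.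
Hypothesis h_sym : forall x, O x -> (h x)^T = h x.
Hypothesis h_unit : forall x, O x -> h x \in unitmx.

Local Notation P := (cometric h).
Local Notation dt := (pmx tt).
Local Notation d i := (pmx (sp i)).
Local Notation gam := (levi_civita sp h).
Local Notation L := (weingarten tt h).

Lemma gam_def i x : gam i x = 2^-1 *: (P x *m first_kind sp h i x).
Proof. by rewrite levi_civita.unlock. Qed.

Lemma weingarten_def x : L x = 2^-1 *: (P x *m dt h x).
Proof. by rewrite weingarten.unlock. Qed.

Lemma first_kindE i x r j :
  first_kind sp h i x r j = d i h x r j + d j h x r i - d r h x i j.
Proof. exact: mxE. Qed.

Lemma gamE i x l j :
  gam i x l j = 2^-1 * \sum_r P x l r * first_kind sp h i x r j.
Proof. by rewrite gam_def [LHS]mxE [X in _ * X]mxE. Qed.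

Lemma smooth_cometric : smooth_mx O P.
Proof. exact: (smooth_invmx Oo h_unit hs). Qed.

Lemma smooth_first_kind i : smooth_mx O (first_kind sp h i).
Proof.
move=> r j; have s k a b : smooth_on O (fun x => d k h x a b).
  exact: (smooth_pmx Oo (sp k) hs).
have s1 := smooth_onM Oo (smooth_on_cst (-1)) (s r i j).
have s2 := smooth_onD Oo (smooth_onD Oo (s i r j) (s j r i)) s1.
by apply: (smooth_on_eq Oo _ s2) => x _; rewrite [RHS]mxE mulN1r.
Qed.

Lemma smooth_gam i : smooth_mx O (gam i).
Proof.
have s := smooth_mxZ Oo (2^-1) (smooth_mxM Oo smooth_cometric (smooth_first_kind i)).
by apply: (smooth_mx_eq Oo _ s) => x _; rewrite gam_def.
Qed.

Lemma smooth_dt p q (X : 'rV[R]_m -> 'M[R]_(p, q)) : smooth_mx O X -> smooth_mx O (dt X).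
Proof. exact: (smooth_pmx Oo). Qed.

Lemma smooth_weingarten : smooth_mx O L.
Proof.
have s := smooth_mxZ Oo (2^-1) (smooth_mxM Oo smooth_cometric (smooth_dt hs)).
by apply: (smooth_mx_eq Oo _ s) => x _; rewrite weingarten_def.
Qed.

Lemma dh_sym k x : O x -> (pmx k h x)^T = pmx k h x.
Proof. by move=> Ox; rewrite -pmx_tr; apply: (pmx_eq Oo k Ox) => y Oy; rewrite h_sym. Qed.

Lemma cometric_sym x : O x -> (P x)^T = P x.
Proof. by move=> Ox; rewrite /cometric trmx_inv h_sym. Qed.

Lemma dh_entryC k x a b : O x -> pmx k h x a b = pmx k h x b a.
Proof. by move=> Ox; rewrite -[in LHS]dh_sym// mxE. Qed.

Lemma first_kindC i j r x : O x -> first_kind sp h i x r j = first_kind sp h j x r i.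
Proof.
move=> Ox.
by rewrite !first_kindE (dh_entryC (sp r) i j Ox) (addrC (d i h x r j)).
Qed.

Lemma gamC i j l x : O x -> gam i x l j = gam j x l i.
Proof.
move=> Ox; rewrite [LHS]gamE [RHS]gamE; congr (_ * _); apply: eq_bigr => r _.
by rewrite (first_kindC i j r Ox).
Qed.

Lemma mul_h_cometric x : O x -> h x *m P x = 1%:M.
Proof. by move=> Ox; rewrite /cometric mulmxV ?h_unit. Qed.

Lemma mul_cometric_h x : O x -> P x *m h x = 1%:M.
Proof. by move=> Ox; rewrite /cometric mulVmx ?h_unit. Qed.

(** The Levi-Civita connection is metric. *)
Lemma metric_compat i x : O x ->
  d i h x = h x *m gam i x + (gam i x)^T *m h x.
Proof.
move=> Ox; have hg : h x *m gam i x = 2^-1 *: first_kind sp h i x.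
  by rewrite gam_def -scalemxAr mulmxA mul_h_cometric// mul1mx.
have gh : (gam i x)^T *m h x = (2^-1 *: first_kind sp h i x)^T.
  by rewrite -hg trmx_mul h_sym.
rewrite gh hg; apply/matrixP => r j.
rewrite [RHS]mxE [X in X + _]mxE [X in _ + X]mxE [X in _ + X]mxE.
rewrite (first_kindE i x r j) (first_kindE i x j r).
rewrite (dh_entryC (sp i) j r Ox) (dh_entryC (sp j) i r Ox) (dh_entryC (sp r) i j Ox).
lra.
Qed.

Lemma d_cometric i x : O x ->
  d i P x = - (gam i x *m P x + P x *m (gam i x)^T).
Proof.
move=> Ox; rewrite (pmx_invmx Oo (sp i) h_unit hs Ox) metric_compat//.
rewrite mulmxDr mulmxDl !mulmxA mul_cometric_h// mul1mx.
by rewrite -(mulmxA _ (h x)) mul_h_cometric// mulmx1.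
Qed.

Lemma dt_metric x : O x -> dt h x = 2 *: (h x *m L x).
Proof.
move=> Ox; rewrite weingarten_def -scalemxAr mulmxA mul_h_cometric// mul1mx scalerA.
by rewrite divff ?scale1r// pnatr_eq0.
Qed.

Lemma cometric_dt x : O x -> P x *m dt h x = 2 *: L x.
Proof. by move=> Ox; rewrite weingarten_def scalerA divff ?scale1r// pnatr_eq0. Qed.

Lemma dt_cometric x : O x -> dt P x = - 2 *: (L x *m P x).
Proof.
move=> Ox; rewrite (pmx_invmx Oo tt h_unit hs Ox) cometric_dt//.
by rewrite -scalemxAl scaleNr.
Qed.

Lemma trace_gam k x : O x -> \tr (gam k x) = 2^-1 * \tr (P x *m d k h x).
Proof.
move=> Ox; rewrite metric_compat// mulmxDr raddfD/= mulmxA mul_cometric_h// mul1mx.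
have -> : \tr (P x *m ((gam k x)^T *m h x)) = \tr (gam k x).
  rewrite -[LHS]mxtrace_tr !trmx_mul trmxK h_sym// cometric_sym//.
  by rewrite mxtrace_mulC mulmxA mul_cometric_h// mul1mx.
lra.
Qed.

(** [Gamma^l_lk] is the derivative of the logarithm of the volume density,
    whose time derivative is [tr L]. *)
Lemma trace_dt_gam k x : O x ->
  \tr (dt (gam k) x) = partial (sp k) (fun y => \tr (L y)) x.
Proof.
move=> Ox; have Ps := smooth_cometric.
have dts i : smooth_mx O (pmx i h) := smooth_pmx Oo i hs.
rewrite -(partial_mxtrace Oo tt (smooth_gam k) Ox).
rewrite (partial_mxtrace Oo (sp k) smooth_weingarten Ox).
transitivity (partial tt (fun y => \tr (2^-1 *: (P y *m d k h y))) x).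
  by apply: (partial_eq tt Oo Ox) => y Oy; rewrite [RHS]mxtraceZ trace_gam.
have s1 := smooth_mxM Oo Ps (dts (sp k)).
have s2 := smooth_mxM Oo Ps (dts tt).
rewrite (partial_mxtrace Oo tt (smooth_mxZ Oo (2^-1) s1) Ox).
have -> : d k L x = 2^-1 *: d k (fun y => P y *m dt h y) x.
  by rewrite -(pmxZ _ _ s2 Ox); apply: (pmx_eq Oo _ Ox) => y _; exact: weingarten_def.
rewrite (pmxZ _ _ s1 Ox).
rewrite (pmxM Oo tt Ps (dts _) Ox) (pmxM Oo (sp k) Ps (dts _) Ox).
rewrite (pmxC Oo tt (sp k) hs Ox) !(pmx_invmx Oo _ h_unit hs Ox).
rewrite !mxtraceZ !mxtraceD; congr (_ * (_ + _)).
rewrite !mulNmx !raddfN/=; congr (- _).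
by rewrite -(mulmxA (_ *m dt h x)) mxtrace_mulC mulmxA.
Qed.

(** The covariant divergence [nabla_i L^i_r]. *)
Definition div_weingarten x r :=
  \sum_i (d i L x + gam i x *m L x - L x *m gam i x) i r.

Local Notation A i := (dt (gam i)).

Lemma dt_gamC i j l x : O x -> A i x l j = A j x l i.
Proof.
move=> Ox; rewrite [LHS]pmxE [RHS]pmxE.
by apply: (partial_eq tt Oo Ox) => y Oy; exact: gamC.
Qed.

(** Both sides are the covariant derivative of [dh/dt] in the direction
    [d_i]: on the left it is obtained from the time derivative of
    [metric_compat], on the right from [dh/dt = 2 h L]. *)
Lemma covariant_dt_metric i x : O x ->
  h x *m A i x + (A i x)^T *m h x
  = 2 *: (h x *m (d i L x + gam i x *m L x - L x *m gam i x)).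
Proof.
move=> Ox; have gs := smooth_gam i; have Ls := smooth_weingarten.
have e1 : dt (d i h) x = dt h x *m gam i x + h x *m A i x
    + ((A i x)^T *m h x + (gam i x)^T *m dt h x).
  have compat y : O y -> d i h y = h y *m gam i y + (gam i y)^T *m h y.
    exact: metric_compat.
  rewrite (pmx_eq Oo tt Ox compat).
  have gts := smooth_mx_tr Oo gs.
  rewrite (pmxD tt (smooth_mxM Oo hs gs) (smooth_mxM Oo gts hs) Ox).
  by rewrite (pmxM Oo tt hs gs Ox) (pmxM Oo tt gts hs Ox) pmx_tr.
have e2 : d i (dt h) x = 2 *: (d i h x *m L x + h x *m d i L x).
  rewrite (pmx_eq Oo (sp i) Ox (Y := fun y => 2 *: (h y *m L y))); last first.
    by move=> y Oy; exact: dt_metric.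
  by rewrite (pmxZ _ _ (smooth_mxM Oo hs Ls) Ox) (pmxM Oo _ hs Ls Ox).
have := pmxC Oo tt (sp i) hs Ox; rewrite e1 e2 (metric_compat i Ox) (dt_metric Ox).
rewrite mulmxDl mulmxBr mulmxDr -scalemxAl -scalemxAr !mulmxA.
move: (h x *m L x *m gam i x) (h x *m A i x) ((A i x)^T *m h x) => a b c.
move: ((gam i x)^T *m h x *m L x) (h x *m gam i x *m L x) (h x *m d i L x) => u v w e.
apply/matrixP => r j; move/(congr1 (fun M : 'M[R]_n => M r j)): e.
by rewrite !mxE; lra.
Qed.

(** The Ricci tensor of the metric [h] at fixed parameters. *)
Definition spatial_ricci x : 'M[R]_n :=
  \matrix_(j, k) \sum_l (d l (gam j) x - d j (gam l) x
    + gam l x *m gam j x - gam j x *m gam l x) l k.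

Lemma smooth_spatial_ricci : smooth_mx O spatial_ricci.
Proof.
have gs := smooth_gam; have gg i j := smooth_mxM Oo (gs i) (gs j).
have ds i j : smooth_mx O (d i (gam j)) := smooth_pmx Oo (sp i) (gs j).
have Bs j l := smooth_mxD Oo (smooth_mxD Oo (smooth_mxD Oo (ds l j)
  (smooth_mxN Oo (ds j l))) (gg l j)) (smooth_mxN Oo (gg j l)).
move=> j k.
have s := smooth_on_sum Oo (index_enum 'I_n) (P := xpredT) (fun l _ => Bs j l l k).
by apply: (smooth_on_eq Oo _ s) => x _; rewrite [RHS]mxE.
Qed.

Section DivergenceFree.
Hypothesis div0 : forall x r, O x -> div_weingarten x r = 0.
Hypothesis trA0 : forall x k, O x -> \tr (A k x) = 0.

(** [h^{ij} dGamma^l_ij/dt] is, up to raising an index, the divergence of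
    [dh/dt] minus half the gradient of its trace. *)
Lemma contracted_dt_gam l x : O x -> \sum_i (A i x *m P x) l i = 0.
Proof.
move=> Ox; pose V : 'cV[R]_n := \col_l \sum_i (A i x *m P x) l i.
suff hV : h x *m V = 0.
  have : V l 0 = 0 by rewrite -[V](mulKmx (h_unit Ox)) hV mulmx0 mxE.
  by rewrite mxE.
apply/matrixP => r c; rewrite [RHS]mxE [LHS]mxE.
transitivity (\sum_i (h x *m A i x *m P x) r i).
  transitivity (\sum_l h x r l * \sum_i (A i x *m P x) l i).
    by apply: eq_bigr => j _; rewrite mxE.
  transitivity (\sum_l \sum_i h x r l * (A i x *m P x) l i).
    by apply: eq_bigr => j _; rewrite mulr_sumr.
  by rewrite exchange_big; apply: eq_bigr => i _; rewrite -mulmxA [RHS]mxE.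
have trA : \sum_i ((A i x)^T *m h x *m P x) r i = 0.
  rewrite -[RHS](trA0 r Ox); apply: eq_bigr => i _.
  by rewrite -mulmxA mul_h_cometric// mulmx1 mxE dt_gamC.
rewrite -[LHS]addr0 -[X in _ + X]trA -big_split/=.
transitivity (\sum_i (P x *m (h x *m A i x + (A i x)^T *m h x)) i r).
  apply: eq_bigr => i _; set E := _ + (A i x)^T *m h x.
  have Esym : E^T = E by rewrite linearD/= !trmx_mul trmxK h_sym// addrC.
  have -> : P x *m E = (E *m P x)^T by rewrite trmx_mul cometric_sym// Esym.
  by rewrite [RHS]mxE /E mulmxDl [RHS]mxE.
transitivity (2 * div_weingarten x r); last by rewrite div0// mulr0.
rewrite /div_weingarten mulr_sumr; apply: eq_bigr => i _.
rewrite covariant_dt_metric// -scalemxAr mulmxA mul_cometric_h// mul1mx.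
by rewrite [LHS]mxE.
Qed.

(* The same tensor [dGamma^l_jk/dt] as [dt (gam j) x l k], arranged so that the
   contraction with [h^{jk}] is the trace of a product. *)
Let W l x : 'M[R]_n := \matrix_(j, k) A j x l k.

Let W_smooth l : smooth_mx O (W l).
Proof.
move=> j k; have s := smooth_dt (smooth_gam j) l k.
by apply: (smooth_on_eq Oo _ s) => x _; rewrite [RHS]mxE.
Qed.

Lemma dt_spatial_ricci x : O x -> dt spatial_ricci x =
  \sum_l (d l (W l) x + \tr (gam l x) *: W l x - W l x *m gam l x
          - (gam l x)^T *m W l x).
Proof.
move=> Ox; have gs := smooth_gam; have As i : smooth_mx O (A i) := smooth_dt (gs i).
have ds i j : smooth_mx O (d i (gam j)) := smooth_pmx Oo (sp i) (gs j).
have gg i j := smooth_mxM Oo (gs i) (gs j).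
apply/matrixP => j k; rewrite pmxE summxE.
pose B l y := d l (gam j) y - d j (gam l) y + gam l y *m gam j y - gam j y *m gam l y.
have Bs l : smooth_mx O (B l).
  apply: (smooth_mxD Oo); last exact: (smooth_mxN Oo (gg j l)).
  apply: (smooth_mxD Oo); last exact: gg.
  exact: (smooth_mxD Oo (ds l j) (smooth_mxN Oo (ds j l))).
transitivity (partial tt (fun y => \sum_l B l y l k) x).
  by apply: (partial_eq tt Oo Ox) => y _; rewrite mxE.
rewrite (partial_sum Oo _ tt (fun l => Bs l l k) Ox).
transitivity (\sum_l (d l (A j) x - d j (A l) x
    + (A l x *m gam j x + gam l x *m A j x)
    - (A j x *m gam l x + gam j x *m A l x)) l k).
  apply: eq_bigr => l _; rewrite -pmxE; congr (fun_of_matrix _ l k).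
  rewrite (pmxD tt _ (smooth_mxN Oo (gg j l)) Ox); last first.
    apply: (smooth_mxD Oo); last exact: gg.
    exact: (smooth_mxD Oo (ds l j) (smooth_mxN Oo (ds j l))).
  rewrite (pmxD tt (smooth_mxD Oo (ds l j) (smooth_mxN Oo (ds j l))) (gg l j) Ox).
  rewrite (pmxD tt (ds l j) (smooth_mxN Oo (ds j l)) Ox).
  rewrite (pmxN tt (ds j l) Ox) (pmxN tt (gg j l) Ox).
  rewrite (pmxC Oo tt (sp l) (gs j) Ox) (pmxC Oo tt (sp j) (gs l) Ox).
  by rewrite (pmxM Oo tt (gs l) (gs j) Ox) (pmxM Oo tt (gs j) (gs l) Ox).
have djA : \sum_l d j (A l) x l k = 0.
  transitivity (partial (sp j) (fun y => \sum_l A l y l k) x).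
    rewrite (partial_sum Oo _ (sp j) (fun l => As l l k) Ox).
    by apply: eq_bigr => l _; rewrite pmxE.
  apply: etrans (partial_cst 0 (sp j) x); apply: (partial_eq (sp j) Oo Ox) => y Oy.
  have := trA0 k Oy; rewrite /mxtrace => e; apply: etrans _ e.
  by apply: eq_bigr => l _; rewrite dt_gamC.
have Ag : \sum_l (A l x *m gam j x) l k = 0.
  transitivity (\sum_l \sum_r A r x l l * gam j x r k).
    by apply: eq_bigr => l _; rewrite mxE; apply: eq_bigr => r _; rewrite dt_gamC.
  rewrite exchange_big big1// => r _; rewrite -mulr_suml.
  by have := trA0 r Ox; rewrite /mxtrace => ->; rewrite mul0r.
have gA : \sum_l (gam l x *m A j x) l k = \sum_l (\tr (gam l x) *: W l x) j k.
  transitivity (\sum_l \sum_r gam r x l l * A j x r k).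
    by apply: eq_bigr => l _; rewrite mxE; apply: eq_bigr => r _; rewrite gamC.
  rewrite exchange_big; apply: eq_bigr => r _.
  by rewrite -mulr_suml [RHS]mxE [X in _ = _ * X]mxE.
have Wg : \sum_l (A j x *m gam l x) l k = \sum_l (W l x *m gam l x) j k.
  apply: eq_bigr => l _; rewrite [LHS]mxE [RHS]mxE; apply: eq_bigr => r _.
  by rewrite [X in _ = X * _]mxE.
have gW : \sum_l (gam j x *m A l x) l k = \sum_l ((gam l x)^T *m W l x) j k.
  transitivity (\sum_l \sum_r gam r x l j * A l x r k).
    by apply: eq_bigr => l _; rewrite mxE; apply: eq_bigr => r _; rewrite gamC.
  rewrite exchange_big; apply: eq_bigr => r _; rewrite [RHS]mxE.
  by apply: eq_bigr => l _; rewrite [X in _ = X * _]mxE [X in _ = _ * X]mxE.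
have dW : \sum_l d l (A j) x l k = \sum_l d l (W l) x j k.
  apply: eq_bigr => l _; rewrite !pmxE.
  by apply: (partial_eq (sp l) Oo Ox) => y _; rewrite [RHS]mxE.
have splitD (X Y Z U : 'I_n -> 'M[R]_n) : \sum_l (X l + Y l - Z l - U l) j k
    = \sum_l X l j k + \sum_l Y l j k - \sum_l Z l j k - \sum_l U l j k.
  by rewrite -big_split -!sumrB; apply: eq_bigr => l _; rewrite !mxE.
rewrite splitD -dW -gA -Wg -gW.
transitivity (\sum_l (d l (A j) x l k - d j (A l) x l k
   + ((A l x *m gam j x) l k + (gam l x *m A j x) l k)
   - ((A j x *m gam l x) l k + (gam j x *m A l x) l k))).
  have entry (X Y Z U V Y' : 'M[R]_n) a b : (X - Y + (Z + U) - (V + Y')) a b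
      = X a b - Y a b + (Z a b + U a b) - (V a b + Y' a b) by rewrite !mxE.
  by apply: eq_bigr => l _; rewrite entry.
rewrite sumrB big_split/= sumrB !big_split/= djA Ag subr0 add0r.
by rewrite opprD addrA.
Qed.

(** The first variation of scalar curvature, for a variation [dh/dt] of
    constant trace and vanishing divergence: by Palatini's formula the trace of
    [dRic/dt] is the divergence of the contractions of [dGamma/dt], which
    vanish.  What remains of [scal'] is the derivative of the inverse metric,
    [- 2 tr (L Ric)]. *)
Lemma trace_dt_spatial_ricci x : O x -> \tr (P x *m dt spatial_ricci x) = 0.
Proof.
move=> Ox; rewrite dt_spatial_ricci// mulmx_sumr raddf_sum/= big1// => l _.
have trPW y : O y -> \tr (P y *m W l y) = 0.
  move=> Oy; rewrite -[RHS](contracted_dt_gam l Oy).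
  rewrite /mxtrace.
  transitivity (\sum_j \sum_k A k y l j * P y j k).
    apply: eq_bigr => j _; rewrite mxE; apply: eq_bigr => k _.
    by rewrite [W l y k j]mxE mulrC.
  by rewrite exchange_big; apply: eq_bigr => k _; rewrite mxE.
have : partial (sp l) (fun y => \tr (P y *m W l y)) x = 0.
  by apply: etrans (partial_cst 0 (sp l) x); apply: (partial_eq (sp l) Oo Ox).
rewrite (partial_mxtrace Oo (sp l) (smooth_mxM Oo smooth_cometric (@W_smooth l)) Ox).
rewrite (pmxM Oo (sp l) smooth_cometric (@W_smooth l) Ox) mxtraceD d_cometric//.
rewrite mulNmx raddfN/= mulmxDl mxtraceD => e.
rewrite !mulmxBr mulmxDr -scalemxAr !raddfB/= raddfD/= mxtraceZ trPW// mulr0 addr0.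
rewrite !mulmxA [\tr (P x *m W l x *m gam l x)]mxtrace_mulC mulmxA.
by apply: etrans _ e; rewrite [RHS]addrC opprD addrA.
Qed.

End DivergenceFree.

End EvolvingMetric.

(** * Curvature of dt^2 + h(t) *)

(** All Christoffel symbols of [G], arranged as in [levi_civita]. *)
HB.lock Definition connection {R : realType} {m : nat} (G : 'rV[R]_m -> 'M[R]_m)
    (i : 'I_m) (x : 'rV[R]_m) : 'M[R]_m :=
  \matrix_(l, j) christoffel G l i j x.

Section Connection.
Context {R : realType} {m : nat} (G : 'rV[R]_m -> 'M[R]_m).

Lemma connectionE i x l j : connection G i x l j = christoffel G l i j x.
Proof. by rewrite connection.unlock mxE. Qed.

Lemma christoffelE l i j x : christoffel G l i j x = 2^-1 *
  \sum_r invmx (G x) l r * (pmx i G x r j + pmx j G x r i - pmx r G x i j).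
Proof. by congr (_ * _); apply: eq_bigr => r _; rewrite !pmxE. Qed.

Lemma ricci_connection x j k : ricci G x j k =
  \sum_l (pmx l (connection G j) x - pmx j (connection G l) x
    + connection G l x *m connection G j x
    - connection G j x *m connection G l x) l k.
Proof.
rewrite mxE; apply: eq_bigr => l _.
have entry (X Y Z U : 'M[R]_m) a b :
    (X - Y + Z - U) a b = X a b - Y a b + (Z a b - U a b).
  by rewrite !mxE addrA.
rewrite entry /riemann; congr (_ - _ + _).
- by rewrite pmxE; congr partial; apply/funext => y; rewrite connectionE.
- by rewrite pmxE; congr partial; apply/funext => y; rewrite connectionE.
- rewrite [X in X - _]mxE [X in _ - X]mxE -sumrB; apply: eq_bigr => r _.
  by rewrite !connectionE.
Qed.

End Connection.

Lemma pmx_block {R : realType} {m a b c d : nat} (i : 'I_m)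
    (A : 'rV[R]_m -> 'M[R]_(a, c)) (B : 'rV[R]_m -> 'M[R]_(a, d))
    (C : 'rV[R]_m -> 'M[R]_(b, c)) (D : 'rV[R]_m -> 'M[R]_(b, d)) x :
  pmx i (fun y => block_mx (A y) (B y) (C y) (D y)) x
  = block_mx (pmx i A x) (pmx i B x) (pmx i C x) (pmx i D x).
Proof.
apply/matrixP => r s; rewrite pmxE.
case: (split_ordP r) => {}r ->; case: (split_ordP s) => {}s ->.
- rewrite block_mxEul pmxE; congr partial; apply/funext => y; exact: block_mxEul.
- rewrite block_mxEur pmxE; congr partial; apply/funext => y; exact: block_mxEur.
- rewrite block_mxEdl pmxE; congr partial; apply/funext => y; exact: block_mxEdl.
- rewrite block_mxEdr pmxE; congr partial; apply/funext => y; exact: block_mxEdr.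
Qed.

(** For [G = dt^2 + h], with [tt] the time index and [sp] the slice indices. *)
Section BlockMetric.
Context {R : realType} {n : nat} {O : set 'rV[R]_(1 + n)}.
Hypothesis Oo : open O.
Variables (h : 'rV[R]_(1 + n) -> 'M[R]_n) (G : 'rV[R]_(1 + n) -> 'M[R]_(1 + n)).
Hypothesis hs : smooth_mx O h.
Hypothesis h_sym : forall x, O x -> (h x)^T = h x.
Hypothesis h_unit : forall x, O x -> h x \in unitmx.
Hypothesis G_block : forall x, O x -> G x = block_mx (1%:M : 'M[R]_1) 0 0 (h x).

Let tt : 'I_(1 + n) := lshift n ord0.
Let sp (i : 'I_n) : 'I_(1 + n) := rshift 1 i.

Local Notation P := (cometric h).
Local Notation dt := (pmx tt).
Local Notation d i := (pmx (sp i)).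
Local Notation gam := (levi_civita sp h).
Local Notation L := (weingarten tt h).

Definition blockE := (block_mxEul, block_mxEur, block_mxEdl, block_mxEdr).

Lemma invmx_G x : O x -> invmx (G x) = block_mx (1%:M : 'M[R]_1) 0 0 (P x).
Proof.
move=> Ox; set Q := block_mx _ _ _ _.
have e : Q *m G x = 1%:M.
  rewrite G_block// mulmx_block !mul0mx !mulmx0 !mulmx1 !addr0 add0r.
  by rewrite (mul_cometric_h h_unit Ox) -scalar_mx_block.
have /andP[_ Gu] : (Q \in unitmx) && (G x \in unitmx) by apply/andP; exact: mulmx1_unit e.
by rewrite -[LHS]mul1mx -e -mulmxA mulmxV// mulmx1.
Qed.

Lemma pmx_G i x : O x -> pmx i G x = block_mx (0 : 'M[R]_1) 0 0 (pmx i h x).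
Proof.
move=> Ox; rewrite (pmx_eq Oo i Ox G_block) pmx_block.
by rewrite !pmx_cst.
Qed.

Lemma connection_time x : O x -> connection G tt x = block_mx (0 : 'M[R]_1) 0 0 (L x).
Proof.
move=> Ox; apply/matrixP => l j; rewrite connectionE christoffelE.
rewrite big_split_ord/= big_ord1 invmx_G//; under eq_bigr do rewrite !pmx_G//.
rewrite !pmx_G// /tt; case: (split_ordP l) => {}l ->; case: (split_ordP j) => {}j ->.
- rewrite blockE big1 => [|r _]; last by rewrite blockE mxE mul0r.
  by rewrite !blockE !mxE !(addr0, subr0, mulr0).
- rewrite blockE big1 => [|r _]; last by rewrite blockE mxE mul0r.
  by rewrite !blockE !mxE !(addr0, subr0, mulr0).
- rewrite big1 => [|r _]; last by rewrite !blockE !mxE !(addr0, subr0, mulr0).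
  by rewrite !blockE !mxE !(addr0, subr0, mulr0, mul0r).
- rewrite !blockE weingarten_def [RHS]mxE [X in _ = _ * X]mxE !mxE mul0r add0r.
  by congr (_ * _); apply: eq_bigr => r _; rewrite !blockE !mxE addr0 subr0.
Qed.

Lemma connection_space i x : O x -> connection G (sp i) x =
  block_mx (0 : 'M[R]_1) (- 2^-1 *: row i (dt h x)) (col i (L x)) (gam i x).
Proof.
move=> Ox; apply/matrixP => l j; rewrite connectionE christoffelE.
rewrite big_split_ord/= big_ord1 invmx_G//; under eq_bigr do rewrite !pmx_G//.
rewrite !pmx_G// /sp; case: (split_ordP l) => {}l ->; case: (split_ordP j) => {}j ->.
- rewrite blockE big1 => [|r _]; last by rewrite blockE mxE mul0r.
  by rewrite !blockE !mxE !(addr0, subr0, mulr0).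
- rewrite blockE big1 => [|r _]; last by rewrite blockE mxE mul0r.
  rewrite !blockE (ord1 l) !mxE eqxx mul1r !addr0 add0r mulrN mulNr.
  by congr (- (_ * _)); congr (pmx _ _ _ _ _).
- rewrite !blockE [RHS]mxE weingarten_def [RHS]mxE [X in _ = _ * X]mxE (ord1 j).
  rewrite [X in _ * (X * _ + _)]mxE mul0r add0r.
  by congr (_ * _); apply: eq_bigr => r _; rewrite !blockE mxE add0r mxE subr0.
- rewrite !blockE gamE [X in _ * (X * _ + _)]mxE mul0r add0r.
  congr (_ * _); apply: eq_bigr => r _; rewrite !blockE first_kindE.
  by [].
Qed.

Lemma d_connection_time i x : O x ->
  pmx i (connection G tt) x = block_mx (0 : 'M[R]_1) 0 0 (pmx i L x).
Proof. by move=> Ox; rewrite (pmx_eq Oo i Ox connection_time) pmx_block !pmx_cst. Qed.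

Lemma d_connection_space i j x : O x ->
  pmx i (connection G (sp j)) x = block_mx (0 : 'M[R]_1)
    (pmx i (fun y => - 2^-1 *: row j (dt h y)) x) (pmx i (fun y => col j (L y)) x)
    (pmx i (gam j) x).
Proof.
by move=> Ox; rewrite (pmx_eq Oo i Ox (connection_space j)) pmx_block pmx_cst.
Qed.

Definition block_arith := (opp_block_mx, add_block_mx, mulmx_block,
  (mul0mx, mulmx0, mul0r), (add0r, addr0, oppr0)).

(** The traced Riccati equation of the slices. *)
Lemma ricci_time_time x : O x ->
  ricci G x tt tt = - \tr (dt L x) - \tr (L x *m L x).
Proof.
move=> Ox; rewrite ricci_connection big_split_ord/= big_ord1 -/tt subrr add0r subrr.
rewrite mxE add0r /mxtrace -!sumrN -big_split/=; apply: eq_bigr => l _.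
rewrite -/(sp l) d_connection_time// d_connection_space// connection_time//.
rewrite connection_space// !block_arith /sp blockE [LHS]mxE; congr (_ + _).
  rewrite mxE !pmxE; congr (- _); congr partial; apply/funext => y; exact: mxE.
by rewrite !mxE; congr (- _); apply: eq_bigr => r _; rewrite mxE.
Qed.

(** The traced Codazzi equation. *)
Lemma ricci_time_space k x : O x ->
  ricci G x tt (sp k) = div_weingarten sp tt h x k - \tr (dt (gam k) x).
Proof.
move=> Ox; rewrite ricci_connection big_split_ord/= big_ord1 -/tt subrr add0r subrr.
rewrite mxE add0r /div_weingarten /mxtrace -sumrB; apply: eq_bigr => l _.
rewrite -/(sp l) d_connection_time// d_connection_space// connection_time//.
rewrite connection_space// !block_arith /sp blockE.
rewrite -(dt_gamC Oo sp tt h_sym l k l Ox).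
have entry (X Y Z U : 'M[R]_n) : (X - Y + Z - U) l k = (X + Z - U) l k - Y l k.
  by rewrite !mxE; ring.
exact: entry.
Qed.

(** The traced Gauss equation, combined with the Riccati equation. *)
Lemma ricci_space_space j k x : O x ->
  ricci G x (sp j) (sp k) = (spatial_ricci sp h x - 2^-1 *: dt (dt h) x
    + 2^-1 *: (dt h x *m L x) - (2^-1 * \tr (L x)) *: dt h x
    + 2^-1 *: ((L x)^T *m dt h x)) j k.
Proof.
move=> Ox; have dhs := smooth_dt Oo tt hs.
rewrite ricci_connection big_split_ord/= big_ord1 -/tt.
rewrite d_connection_time// d_connection_space// connection_time// connection_space//.
rewrite !block_arith /tt /sp blockE -/tt -/sp.
have e1 : pmx tt (fun y => - 2^-1 *: row j (dt h y)) x 0 k = - 2^-1 * dt (dt h) x j k.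
  have rs : smooth_mx O (fun y => row j (dt h y)).
    by move=> a b; apply: (smooth_on_eq Oo _ (dhs j b)) => y _; rewrite mxE.
  rewrite (pmxZ _ _ rs Ox) mxE; congr (_ * _); rewrite !pmxE.
  by congr partial; apply/funext => y; exact: mxE.
have e2 : (- 2^-1 *: row j (dt h x) *m L x) 0 k = - 2^-1 * (dt h x *m L x) j k.
  rewrite -scalemxAl [LHS]mxE; congr (_ * _); rewrite !mxE.
  by apply: eq_bigr => r _; rewrite mxE.
rewrite [X in X + _]mxE e1 [X in _ + X + _]mxE e2.
have outer (M N : 'M[R]_n) a b p q :
    (col a M *m (- 2^-1 *: row b N)) p q = - 2^-1 * (M p a * N b q).
  by rewrite -scalemxAr mxE [X in _ * X]mxE big_ord1 !mxE.
transitivity (- 2^-1 * dt (dt h) x j k - - 2^-1 * (dt h x *m L x) j k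
  + \sum_l ((d l (gam j) x - d j (gam l) x + gam l x *m gam j x - gam j x *m gam l x) l k
     - 2^-1 * (L x l l * dt h x j k) + 2^-1 * (L x l j * dt h x l k))).
  congr (_ + _); apply: eq_bigr => l _.
  rewrite -/(sp l) -/(sp j) !d_connection_space// connection_space// !block_arith.
  rewrite /sp blockE -/(sp l) -/(sp j).
  have entry (X Y Z U V W : 'M[R]_n) : (X - Y + (V + Z) - (W + U)) l k
      = (X - Y + Z - U) l k + V l k - W l k by rewrite !mxE; ring.
  by rewrite entry !outer; ring.
have trL : \sum_l 2^-1 * (L x l l * dt h x j k) = 2^-1 * \tr (L x) * dt h x j k.
  by rewrite -mulr_sumr -mulr_suml mulrA.
have Ldh : \sum_l 2^-1 * (L x l j * dt h x l k) = 2^-1 * ((L x)^T *m dt h x) j k.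
  rewrite -mulr_sumr [in RHS]mxE; congr (_ * _).
  by apply: eq_bigr => l _; rewrite [X in _ = X * _]mxE.
have entry (X Y Z V W : 'M[R]_n) (b : R) :
    (X - 2^-1 *: Y + 2^-1 *: Z - b *: V + 2^-1 *: W) j k
    = X j k - 2^-1 * Y j k + 2^-1 * Z j k - b * V j k + 2^-1 * W j k by rewrite !mxE.
by rewrite entry [spatial_ricci sp h x j k]mxE big_split sumrB/= trL Ldh; ring.
Qed.

Lemma hessianE F i j x : (forall k y, O y -> partial (sp k) F y = 0) -> O x ->
  hessian G F x i j = partial i (partial j F) x - connection G i x tt j * partial tt F x.
Proof.
move=> F0 Ox; rewrite mxE big_split_ord/= big_ord1 connectionE -/tt.
by rewrite big1 ?addr0// => l _; rewrite F0// mulr0.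
Qed.

End BlockMetric.

(** * The soliton equation in a product chart *)

(** Elimination of [S'] and [H''], where [a, b, c, e, u, v, w] stand for
    [q], [H], [y''], [eps / 2], [y'], [y] and [tr (L L')]. *)
Lemma third_order_balance {R : realFieldType} (a b c e u v w : R) :
  - (2 * w) + c + 2 * b * (- a + u + e) - (u * b + v * (- a + u + e))
    = -2 * (w + b * a - v * a - e * b) ->
  c + (b - v) * u = (a + e) * v.
Proof. by move=> ?; lra. Qed.

Section LocalSoliton.
Context {R : realType} {n : nat} {O : set 'rV[R]_(1 + n)}.
Hypothesis Oo : open O.
Variables (h : 'rV[R]_(1 + n) -> 'M[R]_n) (G : 'rV[R]_(1 + n) -> 'M[R]_(1 + n)).
Hypothesis hs : smooth_mx O h.
Hypothesis h_sym : forall x, O x -> (h x)^T = h x.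
Hypothesis h_unit : forall x, O x -> h x \in unitmx.
Hypothesis G_block : forall x, O x -> G x = block_mx (1%:M : 'M[R]_1) 0 0 (h x).

Let tt : 'I_(1 + n) := lshift n ord0.
Let sp (i : 'I_n) : 'I_(1 + n) := rshift 1 i.

Variables (F : 'rV[R]_(1 + n) -> R) (eps : R).
Hypothesis Fs : smooth_on O F.
Hypothesis F_time : forall k x, O x -> partial (sp k) F x = 0.

Local Notation P := (cometric h).
Local Notation dt := (pmx tt).
Local Notation d i := (pmx (sp i)).
Local Notation gam := (levi_civita sp h).
Local Notation L := (weingarten tt h).
Local Notation r := (spatial_ricci sp h).
Local Notation y := (partial tt F).
Local Notation H := (fun x => \tr (L x)).
Local Notation q := (fun x => \tr (L x *m L x)).

Hypothesis H_time : forall k x, O x -> partial (sp k) H x = 0.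
Hypothesis soliton : forall x, O x ->
  ricci G x + hessian G F x + (eps / 2) *: G x = 0.

Let Ls : smooth_mx O L := smooth_weingarten Oo tt hs h_unit.

Lemma soliton_entry i j x : O x ->
  ricci G x i j + hessian G F x i j + (eps / 2) * G x i j = 0.
Proof.
move=> Ox; have := congr1 (fun M : 'M[R]_(1 + n) => M i j) (soliton Ox).
by rewrite /= !mxE.
Qed.

Lemma soliton_time_time x : O x ->
  partial tt H x = - \tr (L x *m L x) + partial tt y x + eps / 2.
Proof.
move=> Ox; have := soliton_entry tt tt Ox.
rewrite (ricci_time_time Oo h_unit G_block Ox).
rewrite (hessianE G tt tt F_time Ox).
rewrite (connection_time Oo h_unit G_block Ox) (G_block Ox).
rewrite /tt !block_mxEul !mxE eqxx mul0r subr0 mulr1.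
rewrite (partial_mxtrace Oo _ Ls Ox) -/tt => e; lra.
Qed.

Lemma partial_space_F i k x : O x -> partial i (partial (sp k) F) x = 0.
Proof.
move=> Ox; apply: etrans (partial_cst 0 i x).
by apply: (partial_eq i Oo Ox); exact: F_time.
Qed.

Lemma soliton_divergence_free k x : O x -> div_weingarten sp tt h x k = 0.
Proof.
move=> Ox; have := soliton_entry tt (sp k) Ox.
rewrite (ricci_time_space Oo h_sym h_unit G_block k Ox).
rewrite (trace_dt_gam Oo sp tt hs h_sym h_unit k Ox) H_time//.
rewrite (hessianE G tt (sp k) F_time Ox) partial_space_F//.
rewrite (connection_time Oo h_unit G_block Ox) (G_block Ox).
rewrite /tt /sp !block_mxEur !mxE !mul0r !mulr0.
by rewrite !subr0 !addr0.
Qed.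

Lemma dt_gam_traceless k x : O x -> \tr (dt (gam k) x) = 0.
Proof.
by move=> Ox; rewrite (trace_dt_gam Oo sp tt hs h_sym h_unit k Ox) H_time.
Qed.

Lemma soliton_space x : O x -> r x = 2^-1 *: dt (dt h) x - 2^-1 *: (dt h x *m L x)
  + (2^-1 * \tr (L x)) *: dt h x - 2^-1 *: ((L x)^T *m dt h x)
  - (2^-1 * y x) *: dt h x - (eps / 2) *: h x.
Proof.
move=> Ox; apply/matrixP => j k; have := soliton_entry (sp j) (sp k) Ox.
rewrite (ricci_space_space Oo hs h_unit G_block j k Ox).
rewrite (hessianE G (sp j) (sp k) F_time Ox) partial_space_F//.
rewrite (connection_space Oo h_unit G_block j Ox) (G_block Ox).
rewrite /sp /tt block_mxEur block_mxEdr -/tt -/sp.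
have -> : (- 2^-1 *: row j (dt h x)) 0 k = - 2^-1 * dt h x j k.
  by rewrite mxE; congr (_ * _); exact: mxE.
move: (r x) (dt (dt h) x) (dt h x *m L x) (dt h x) ((L x)^T *m dt h x) (h x).
move=> A B C D E K; rewrite !mxE; move: (A j k) (B j k) => a b; lra.
Qed.

(** The slice components of the soliton equation with an index raised:
    [Ric + eps / 2 = L' + (H - y) L]. *)
Lemma soliton_endomorphism x : O x -> P x *m r x =
  dt L x + \tr (L x) *: L x - y x *: L x - (eps / 2)%:M.
Proof.
move=> Ox; have Ps := smooth_cometric Oo hs h_unit.
have dhs := smooth_dt Oo tt hs.
have Pd := cometric_dt tt h Ox.
have PdL : P x *m (dt h x *m L x) = 2 *: (L x *m L x).
  by rewrite mulmxA Pd scalemxAl.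
have Pdd : P x *m dt (dt h) x = 2 *: dt L x + 4 *: (L x *m L x).
  have : dt (fun z => P z *m dt h z) x = 2 *: dt L x.
    rewrite -(pmxZ 2 tt Ls Ox); apply: (pmx_eq Oo tt Ox) => z Oz.
    exact: cometric_dt.
  rewrite (pmxM Oo tt Ps dhs Ox) (dt_cometric Oo tt hs h_unit Ox).
  rewrite -scalemxAl -mulmxA Pd -scalemxAr scalerA => <-.
  move: (L x *m L x) (P x *m dt (dt h) x) => A B.
  by apply/matrixP => a b; rewrite !mxE; lra.
have hL : (L x)^T *m h x = h x *m L x.
  have e : (h x *m L x)^T = h x *m L x.
    have <- : 2^-1 *: dt h x = h x *m L x.
      by rewrite (dt_metric tt h_unit Ox) scalerA mulVf ?scale1r// pnatr_eq0.
    by rewrite linearZ/= (dh_sym Oo h_sym tt Ox).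
  by rewrite -[RHS]e trmx_mul h_sym.
have PLd : P x *m ((L x)^T *m dt h x) = 2 *: (L x *m L x).
  rewrite (dt_metric tt h_unit Ox) -!scalemxAr; congr (_ *: _).
  by rewrite (mulmxA (L x)^T) hL !mulmxA (mul_cometric_h h_unit Ox) mul1mx.
rewrite (soliton_space Ox) !(mulmxBr, mulmxDr) -!scalemxAr.
rewrite Pdd PdL PLd Pd (mul_cometric_h h_unit Ox).
apply/matrixP => j k.
move: (dt L x) (L x *m L x) (L x) (\tr (L x)) (y x) => A B C a b.
rewrite !mxE mulr_natr; case: (j == k); rewrite ?mulr1n ?mulr0n; lra.
Qed.

Let Hs : smooth_on O H := smooth_mxtrace Oo Ls.
Let ys : smooth_on O y := smooth_on_partial tt Fs.
Let qs : smooth_on O q := smooth_mxtrace Oo (smooth_mxM Oo Ls Ls).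

Lemma soliton_scalar x : O x -> \tr (P x *m r x) =
  partial tt H x + \tr (L x) * \tr (L x) - y x * \tr (L x) - eps / 2 *+ n.
Proof.
move=> Ox; rewrite soliton_endomorphism// !raddfB/= raddfD/= !linearZ/=.
by rewrite (partial_mxtrace Oo tt Ls Ox) mxtrace_scalar.
Qed.

Lemma dt_q x : O x -> partial tt q x = 2 * \tr (L x *m dt L x).
Proof.
move=> Ox; rewrite (partial_mxtrace Oo tt (smooth_mxM Oo Ls Ls) Ox).
rewrite (pmxM Oo tt Ls Ls Ox) mxtraceD (mxtrace_mulC (dt L x)); ring.
Qed.

(** The equality of two expressions of the time derivative of the scalar
    curvature of the slices: the derivative of [soliton_scalar], and the first
    variation formula, in which [Ric] is replaced by
    [soliton_endomorphism]. *)
Lemma soliton_third_order x : O x ->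
  partial tt (partial tt y) x + (\tr (L x) - y x) * partial tt y x
  = (\tr (L x *m L x) + eps / 2) * y x.
Proof.
move=> Ox; have Ps := smooth_cometric Oo hs h_unit.
have rs : smooth_mx O r := smooth_spatial_ricci Oo sp hs h_unit.
have variation : partial tt (fun z => \tr (P z *m r z)) x
    = - 2 * \tr (L x *m (P x *m r x)).
  rewrite (partial_mxtrace Oo tt (smooth_mxM Oo Ps rs) Ox) (pmxM Oo tt Ps rs Ox).
  rewrite mxtraceD (trace_dt_spatial_ricci Oo hs h_sym h_unit _ _ Ox).
  - by rewrite addr0 (dt_cometric Oo tt hs h_unit Ox) -scalemxAl linearZ/= mulmxA.
  - by move=> z k Oz; exact: soliton_divergence_free.
  - by move=> z k Oz; exact: dt_gam_traceless.
have dHs : smooth_on O (partial tt H) := smooth_on_partial tt Hs.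
have dys : smooth_on O (partial tt y) := smooth_on_partial tt ys.
have direct : partial tt (fun z => \tr (P z *m r z)) x =
    partial tt (partial tt H) x + 2 * \tr (L x) * partial tt H x
    - (partial tt y x * \tr (L x) + y x * partial tt H x).
  have HHs := smooth_onM Oo Hs Hs.
  have yHs := smooth_onM Oo (smooth_on_cst (-1)) (smooth_onM Oo ys Hs).
  have cs := smooth_on_cst (O := O) (- (eps / 2 *+ n)).
  transitivity (partial tt (fun z => partial tt H z + \tr (L z) * \tr (L z)
      + -1 * (y z * \tr (L z)) + - (eps / 2 *+ n)) x).
    by apply: (partial_eq tt Oo Ox) => z Oz; rewrite soliton_scalar// mulN1r.
  rewrite (partialD tt (smooth_onD Oo (smooth_onD Oo dHs HHs) yHs) cs Ox).
  rewrite (partialD tt (smooth_onD Oo dHs HHs) yHs Ox) (partialD tt dHs HHs Ox).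
  rewrite (partialM tt (smooth_on_cst (-1)) (smooth_onM Oo ys Hs) Ox).
  rewrite (partialM tt ys Hs Ox) (partialM tt Hs Hs Ox) !partial_cst.
  move: (partial tt (partial tt H) x) (partial tt H x) (partial tt y x) (y x) (\tr (L x)).
  by move=> a b c e w; ring.
have ddH : partial tt (partial tt H) x
    = - partial tt q x + partial tt (partial tt y) x.
  have Nqs := smooth_onM Oo (smooth_on_cst (-1)) qs.
  have cs := smooth_on_cst (O := O) (eps / 2).
  transitivity (partial tt (fun z => -1 * \tr (L z *m L z) + partial tt y z + eps / 2) x).
    by apply: (partial_eq tt Oo Ox) => z Oz; rewrite soliton_time_time// mulN1r.
  rewrite (partialD tt (smooth_onD Oo Nqs dys) cs Ox) (partialD tt Nqs dys Ox).
  by rewrite (partialM tt (smooth_on_cst (-1)) qs Ox) !partial_cst; ring.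
have LPr : \tr (L x *m (P x *m r x)) = \tr (L x *m dt L x)
    + \tr (L x) * \tr (L x *m L x) - y x * \tr (L x *m L x) - eps / 2 * \tr (L x).
  rewrite soliton_endomorphism// !mulmxBr mulmxDr -!scalemxAr mul_mx_scalar.
  by rewrite !raddfB/= raddfD/= !linearZ.
have dH := soliton_time_time Ox.
move: variation; rewrite direct ddH (dt_q Ox) LPr dH.
exact: third_order_balance.
Qed.

End LocalSoliton.

(** * Positive definite matrices *)

Section PositiveDefinite.
Context {R : rcfType}.

Definition posdef n (h : 'M[R]_n) :=
  h^T = h /\ forall v : 'rV[R]_n, v != 0 -> 0 < (v *m h *m v^T) 0 0.

(** Cholesky's factorization, by splitting off the first row and column: the
    Schur complement [S] is again positive definite. *)
Lemma posdef_factor n (h : 'M[R]_n) : posdef h ->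
  exists2 C : 'M[R]_n, C \in unitmx & h = C *m C^T.
Proof.
elim: n h => [|n IH] h [h_sym h_pos].
  by exists 1%:M; [exact: unitmx1|apply/matrixP => -[]].
rewrite -[n.+1]/(1 + n)%N in h h_sym h_pos *.
pose a := h 0 0; pose b := ursubmx h; pose D := drsubmx h.
have ulh : ulsubmx h = a%:M.
  by rewrite [LHS]mx11_scalar; congr (_%:M); rewrite !mxE; congr (h _ _); exact: val_inj.
have dlh : dlsubmx h = b^T by rewrite /b trmx_ursub h_sym.
have D_sym : D^T = D by rewrite /D trmx_drsub h_sym.
have hE : h = block_mx a%:M b b^T D by rewrite -[LHS]submxK ulh dlh.
have a_gt0 : 0 < a.
  have e0 : (delta_mx 0 0 : 'rV[R]_(1 + n)) != 0.
    apply/eqP => /matrixP/(_ 0 0); rewrite !mxE !eqxx => /eqP.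
    by rewrite oner_eq0.
  have := h_pos _ e0; rewrite -rowE trmx_delta -colE !mxE.
  by [].
pose S := D - a^-1 *: (b^T *m b).
pose F : 'M[R]_(1 + n) := block_mx 1%:M 0 (a^-1 *: b^T) 1%:M.
have F_unit : F \in unitmx by rewrite unitmxE det_lblock !det1 mulr1 unitr1.
have FE : h = F *m block_mx a%:M 0 0 S *m F^T.
  rewrite hE /F tr_block_mx !mulmx_block !trmx1 !trmx0 !(mul0mx, mulmx0, mul1mx, mulmx1).
  rewrite !(addr0, add0r) linearZ/= trmxK mul_mx_scalar scalerA divff ?gt_eqF// scale1r.
  rewrite mul_scalar_mx scalerA divff ?gt_eqF// scale1r -scalemxAr.
  by rewrite /S addrC subrK.
have S_pos : posdef S.
  split; first by rewrite /S linearB/= linearZ/= trmx_mul trmxK D_sym.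
  move=> v v0; pose w : 'rV[R]_(1 + n) := row_mx 0 v *m invmx F.
  have wF : w *m F = row_mx 0 v by rewrite /w mulmxKV.
  have w0 : w != 0.
    apply: contraNneq v0 => w0; move: wF; rewrite w0 mul0mx -row_mx0.
    by move=> /eq_row_mx[_ <-].
  have := h_pos w w0; rewrite FE.
  have -> : w *m (F *m block_mx a%:M 0 0 S *m F^T) *m w^T
      = w *m F *m block_mx a%:M 0 0 S *m (w *m F)^T by rewrite (trmx_mul w F) !mulmxA.
  rewrite wF mul_row_block !(mul0mx, mulmx0) !(addr0, add0r).
  by rewrite tr_row_mx mul_row_col mul0mx add0r.
have [C' C'u SE] := IH S S_pos.
pose B : 'M[R]_(1 + n) := block_mx (Num.sqrt a)%:M 0 0 C'.
have s_gt0 : 0 < Num.sqrt a by rewrite sqrtr_gt0.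
exists (F *m B).
  rewrite unitmx_mul F_unit /= unitmxE det_lblock det_scalar1 unitrM -unitmxE C'u andbT.
  by rewrite unitfE gt_eqF.
rewrite trmx_mul mulmxA -(mulmxA F) {1}FE; congr (_ *m _ *m _).
rewrite /B tr_block_mx !trmx0 tr_scalar_mx mulmx_block !(mul0mx, mulmx0) !(addr0, add0r).
by rewrite -SE -scalar_mxM -expr2 sqr_sqrtr// ltW.
Qed.

Lemma posdef_unit n (h : 'M[R]_n) : posdef h -> h \in unitmx.
Proof. by case/posdef_factor => C Cu ->; rewrite unitmx_mul unitmx_tr Cu. Qed.

Lemma sqr_sum_le n (x : 'I_n -> R) :
  (\sum_i x i) ^+ 2 <= n%:R * \sum_i x i ^+ 2.
Proof.
have : 0 <= \sum_i \sum_j (x i - x j) ^+ 2.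
  by apply: sumr_ge0 => i _; apply: sumr_ge0 => j _; exact: sqr_ge0.
have -> : \sum_i \sum_j (x i - x j) ^+ 2
    = 2 * (n%:R * \sum_i x i ^+ 2 - (\sum_i x i) ^+ 2).
  have -> : \sum_i \sum_j (x i - x j) ^+ 2 =
      \sum_i (n%:R * x i ^+ 2 - 2 * x i * \sum_j x j + \sum_j x j ^+ 2).
    apply: eq_bigr => i _.
    have -> : n%:R * x i ^+ 2 = \sum_(j < n) x i ^+ 2.
      by rewrite sumr_const card_ord mulr_natl.
    rewrite mulr_sumr -sumrB -big_split/=; apply: eq_bigr => j _; ring.
  rewrite big_split sumrB/= -mulr_sumr -mulr_suml -mulr_sumr sumr_const card_ord.
  by rewrite -mulr_natl; ring.
by rewrite pmulr_rge0// subr_ge0.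
Qed.

(** If [h = C C^T], conjugation by [C^T] turns an endomorphism that is
    symmetric for [h] into a symmetric matrix [N], and
    [tr N^2 >= sum_i N_ii^2 >= (sum_i N_ii)^2 / n]. *)
Lemma sqr_mxtrace_le n (h M : 'M[R]_n) : posdef h -> (h *m M)^T = h *m M ->
  \tr M ^+ 2 <= n%:R * \tr (M *m M).
Proof.
case/posdef_factor => C Cu ->; rewrite trmx_mul => hM.
pose N := C^T *m M *m invmx C^T.
have Ctu : C^T \in unitmx by rewrite unitmx_tr.
have trN : \tr N = \tr M by rewrite /N mxtrace_mulC mulmxA mulVmx// mul1mx.
have trNN : \tr (N *m N) = \tr (M *m M).
  rewrite /N !mulmxA mulmxKV// mxtrace_mulC !mulmxA mulVmx// mul1mx.
  by [].
have N_sym : N^T = N.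
  have -> : N = invmx C *m (C *m C^T *m M) *m invmx C^T.
    by rewrite !mulmxA mulVmx// mul1mx.
  rewrite -hM !trmx_mul !trmx_inv !trmxK.
  by rewrite -hM !trmx_mul !trmxK !mulmxA.
rewrite -trN -trNN; apply: le_trans (sqr_sum_le _) _.
rewrite ler_wpM2l// /mxtrace ler_sum// => i _.
have N_symE j : N j i = N i j by rewrite -[in LHS]N_sym [LHS]mxE.
rewrite [X in _ <= X]mxE (bigD1 i)//= expr2 lerDl sumr_ge0// => j _.
by rewrite N_symE -expr2 sqr_ge0.
Qed.

End PositiveDefinite.

(** * Profiles of the potential *)

Section TimeLines.
Context {R : realType} {n : nat}.

Let tt : 'I_(1 + n) := lshift n ord0.

Lemma row_mx_add_time (s t : R) (x : 'rV[R]_n) :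
  row_mx (s + t)%:M x = s *: delta_mx 0 tt + row_mx t%:M x :> 'rV[R]_(1 + n).
Proof.
apply/rowP => i; rewrite [RHS]mxE [X in _ = X + _]mxE [X in _ = _ * X + _]mxE.
case: (split_ordP i) => {}i ->.
  by rewrite !row_mxEl (ord1 i) !mxE !eqxx !mulr1n mulr1.
by rewrite !row_mxEr /tt eq_rlshift mulr0 add0r.
Qed.

Lemma is_derive_time (Q : 'rV[R]_(1 + n) -> R) (t : R) (x : 'rV[R]_n) :
  derivable Q (row_mx t%:M x) (delta_mx 0 tt) ->
  is_derive t 1 (fun s => Q (row_mx s%:M x)) (partial tt Q (row_mx t%:M x)).
Proof.
have e : (fun h : R => h^-1 *: (Q (row_mx (h *: (1 : R) + t)%:M x) - Q (row_mx t%:M x)))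
    = (fun h : R => h^-1 *: (Q (h *: delta_mx 0 tt + row_mx t%:M x) - Q (row_mx t%:M x))).
  by apply/funext => h; rewrite [h *: (1 : R)]mulr1 row_mx_add_time.
by move=> Qd; apply: DeriveDef; rewrite /partial /derivable /derive /= e.
Qed.

Lemma partial_time_only (phi : R -> R) (k : 'I_n) (z : 'rV[R]_(1 + n)) :
  partial (rshift 1 k) (fun w => phi (w 0 tt)) z = 0.
Proof.
apply: etrans (partial_cst (phi (z 0 tt)) (rshift 1 k) z).
pose v : 'rV[R]_(1 + n) := delta_mx 0 (rshift 1 k).
have e : (fun h : R => h^-1 *: (phi ((h *: v + z) 0 tt) - phi (z 0 tt)))
    = (fun h : R => h^-1 *: (phi (z 0 tt) - phi (z 0 tt))).
  by apply/funext => h; rewrite !mxE eqxx /tt eq_lrshift mulr0 add0r.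
by rewrite /partial /derive /= e.
Qed.

End TimeLines.

Lemma strictly_monotone_of_derivatives {R : realType} (f y dy : R -> R) :
  (forall t : R, 0 < t -> is_derive t (1 : R) f (y t)) ->
  (forall t : R, 0 < t -> is_derive t (1 : R) y (dy t)) ->
  (forall t : R, 0 < t -> y t < 0 /\ dy t < 0) ->
  strictly_decreasing_on `]0, +oo[ f /\ strictly_concave_on `]0, +oo[ f.
Proof.
move=> fd yd neg.
have y_decr s t : 0 < s -> s < t -> y t < y s.
  move=> s0 st; have [r /andP[sr _]|r /andP[sr _] e] := @mean_value R y dy s t st.
    by apply: yd; exact: lt_le_trans sr.
  by rewrite -subr_lt0 e nmulr_rlt0 ?subr_gt0//; have [] := neg r (lt_trans s0 sr).
split=> [s t|s t a]; rewrite /= !in_itv/= !andbT => s0 t0.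
  move=> st; have [r /andP[sr _]|r /andP[sr _] e] := @mean_value R f y s t st.
    by apply: fd; exact: lt_le_trans sr.
  by rewrite -subr_lt0 e nmulr_rlt0 ?subr_gt0//; have [] := neg r (lt_trans s0 sr).
move=> + /andP[a0 a1].
wlog st : s t a s0 t0 a0 a1 / s < t.
  move=> wl; rewrite neq_lt => /orP[st|ts]; first by apply: wl => //; rewrite lt_eqF.
  have := wl t s (1 - a) t0 s0.
  rewrite subKr (addrC ((1 - a) * f t)) (addrC ((1 - a) * t)).
  by apply=> //; [lra|lra|rewrite lt_eqF].
move=> _; pose p := a * s + (1 - a) * t; rewrite -/p.
have sp : s < p by rewrite /p; nra.
have pt : p < t by rewrite /p; nra.
have [r /andP[sr _]|r /andP[sr rp] e1] := @mean_value R f y s p sp.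
  by apply: fd; exact: lt_le_trans sr.
have [w /andP[pw _]|w /andP[pw wt] e2] := @mean_value R f y p t pt.
  by apply: fd; apply: lt_le_trans pw; exact: lt_trans sp.
have ywr : y w < y r by apply: y_decr; [exact: lt_trans sr|exact: lt_trans pw].
have e1' : p - s = (1 - a) * (t - s) by rewrite /p; ring.
have e2' : t - p = a * (t - s) by rewrite /p; ring.
have c0 : 0 < a * (1 - a) * (t - s) by rewrite !mulr_gt0// subr_gt0.
have : a * (1 - a) * (t - s) * (y w - y r) < 0 by rewrite pmulr_rlt0// subr_lt0.
have -> : a * (1 - a) * (t - s) * (y w - y r) = (1 - a) * (f t - f p) - a * (f p - f s).
  by rewrite e1 e2 e1' e2'; ring.
lra.
Qed.

(** The hypothesis on [F] says that [f] extends to an even smooth function of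
    [s], the restriction of [F] to a line; so [y -> 0] at [0], and [dy]
    converges. *)
Lemma even_profile_limit {R : realType} {m : nat} (O : set 'rV[R]_m)
    (F : 'rV[R]_m -> R) (x : 'rV[R]_m) (i : 'I_m) (del : R) (f y dy : R -> R) :
  smooth_on O F -> 0 < del ->
  (forall s : R, `|s| < del -> O (x + s *: delta_mx 0 i)) ->
  (forall s : R, s != 0 -> `|s| < del -> F (x + s *: delta_mx 0 i) = f `|s|) ->
  (forall t : R, 0 < t -> is_derive t (1 : R) f (y t)) ->
  (forall t : R, 0 < t -> is_derive t (1 : R) y (dy t)) ->
  (y t * dy t) @[t --> 0^'+] --> 0 /\ f t @[t --> 0^'+] --> F x.
Proof.
move=> Fs del0 xO Ff fd yd.
pose e : 'rV[R]_m := delta_mx 0 i.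
pose phi k s := iter k (partial i) F (x + s *: e).
have phi_deriv k s : `|s| < del -> is_derive s (1 : R) (phi k) (phi k.+1 s).
  move=> sdel; apply: is_derive_line.
  have ks : smooth_on O (iter k (partial i) F).
    by elim: k => [|k IH]; [exact: Fs|exact: (smooth_on_partial i IH)].
  exact: (smooth_on_derivable ks (xO s sdel)).
have phi_cvg k : phi k t @[t --> 0^'+] --> phi k 0.
  apply: cvg_at_right_filter; have := phi_deriv k 0; rewrite normr0 => /(_ del0).
  by move/is_derive_continuous.
have near0 t : 0 < t < del -> `|t| < del by move=> /andP[t0 ?]; rewrite gtr0_norm.
have f_phi t : 0 < t < del -> f t = phi 0 t.
  move=> tdel; case/andP: (tdel) => t0 _; rewrite /phi/= Ff ?near0 ?gt_eqF//.
  by rewrite gtr0_norm.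
have near_eq (u v : R -> R) t : 0 < t < del -> (forall s, 0 < s < del -> u s = v s) ->
    \forall s \near t, u s = v s.
  move=> /andP[t0 tdel] uv.
  near=> s; apply: uv; apply/andP; split; near: s; [exact: lt_nbhsr|exact: lt_nbhsl].
have y_phi t : 0 < t < del -> y t = phi 1 t.
  move=> tdel; case/andP: (tdel) => t0 _.
  have d1 := near_eq_is_derive (near_eq _ _ _ tdel f_phi) (fd t t0).
  have d2 := phi_deriv 0 t (near0 t tdel).
  by rewrite -(@derive_val _ _ _ _ _ _ _ d1) (@derive_val _ _ _ _ _ _ _ d2).
have dy_phi t : 0 < t < del -> dy t = phi 2 t.
  move=> tdel; case/andP: (tdel) => t0 _.
  have d1 := near_eq_is_derive (near_eq _ _ _ tdel y_phi) (yd t t0).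
  have d2 := phi_deriv 1 t (near0 t tdel).
  by rewrite -(@derive_val _ _ _ _ _ _ _ d1) (@derive_val _ _ _ _ _ _ _ d2).
have phi1_0 : phi 1 0 = 0.
  have d0 : is_derive (0 : R) (1 : R) (phi 0) (phi 1 0).
    by apply: phi_deriv; rewrite normr0.
  have d0' : is_derive (- (0 : R)) (1 : R) (phi 0) (phi 1 0) by rewrite oppr0.
  have dN : is_derive (0 : R) (1 : R) (fun s => phi 0 (- s)) (- phi 1 0).
    by apply: is_derive_eq; rewrite /GRing.scale/=; ring.
  have even : \forall s \near (0 : R), phi 0 (- s) = phi 0 s.
    apply/nbhs_ballP; exists del => //= s; rewrite -ball_normE/= sub0r normrN => sdel.
    have [->|s0] := eqVneq s 0; first by rewrite oppr0.
    by rewrite /phi/= !Ff ?oppr_eq0// normrN.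
  have d1 := near_eq_is_derive even dN.
  have : - phi 1 0 = phi 1 0.
    by rewrite -[LHS](@derive_val _ _ _ _ _ _ _ d1) (@derive_val _ _ _ _ _ _ _ d0).
  lra.
split.
  have : (phi 1 t * phi 2 t) @[t --> 0^'+] --> phi 1 0 * phi 2 0 by apply: cvgM.
  rewrite phi1_0 mul0r; apply: cvg_trans; apply: near_eq_cvg.
  near=> t; have tdel : 0 < t < del.
    by apply/andP; split; near: t; [exact: nbhs_right_gt|exact: nbhs_right_lt].
  by rewrite y_phi// dy_phi.
have := phi_cvg 0; rewrite {2}/phi/= scale0r addr0; apply: cvg_trans; apply: near_eq_cvg.
near=> t; rewrite f_phi//.
by apply/andP; split; near: t; [exact: nbhs_right_gt|exact: nbhs_right_lt].
Unshelve. all: by end_near. Qed.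

(** * Cohomogeneity one solitons *)

Section Cohomogeneity.
Context {R : realType} {n k : nat} {M : manifold R n.+1} {P : manifold R n}.
Context {g : tensor2 M} {u : M -> R} {eps : R}.
Context {N : set M} {Phi : R -> P -> M} {h : R -> tensor2 P} {f : R -> R}.
Hypothesis soliton : expanding_gradient_soliton g u eps.
Hypothesis coh : cohomogeneity_one k g u N Phi h f.

Lemma off_orbit p : ~ N p -> exists t q, 0 < t /\ p = Phi t q.
Proof.
have [_ _ surj] := coh1_bij coh.
by move=> /surj[[t q] /= t0 <-]; exists t, q.
Qed.

Lemma slice_inhabited : exists q : P, True.
Proof.
apply: contrapT => noP; apply: (coh1_noncompact coh).
have <- : N = [set: M].
  apply/seteqP; split=> // p _; apply: contrapT => /off_orbit[t [q _]].
  by apply: noP; exists q.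
exact: coh1_special_compact coh.
Qed.

Lemma orbit_inhabited : exists q, N q.
Proof.
have [p _] := slice_inhabited; apply: contrapT => noN.
have := coh1_distance coh p (@ltr01 R); rewrite /rdist_to.
have -> : [set rdist g (Phi 1 p) q | q in N] = set0.
  by apply/seteqP; split=> // x [q Nq _]; apply: noN; exists q.
by rewrite ereal_inf0.
Qed.

Lemma dim_gt0 : (0 < n)%N.
Proof.
have [kn _] := coh1_special_codim coh; have := coh1_sphere_dim coh.
by rewrite ltnS in kn; move=> /leq_trans; apply.
Qed.

(** In a polar chart, with [x] the coordinates of a point of the special orbit,
    the point with coordinates [x + s e_0] lies on the slice [t = |s|]. *)
Lemma profile_at_orbit : exists (O : set 'rV[R]_n.+1) (F : 'rV[R]_n.+1 -> R)
    (x : 'rV[R]_n.+1) (del : R),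
  [/\ smooth_on O F, 0 < del,
    forall s : R, `|s| < del -> O (x + s *: delta_mx 0 ord0),
    forall s : R, s != 0 -> `|s| < del -> F (x + s *: delta_mx 0 ord0) = f `|s|
    & F x = f 0].
Proof.
have [q Nq] := orbit_inhabited.
have [c [[c_atlas c_slice] c_polar] cq] := coh1_collapse coh Nq.
have [dom_open img_open paramK _ _] := atlas_chart c_atlas.
have [_ _ us _] := soliton.
pose x := Defs.coord c q; pose e : 'rV[R]_n.+1 := delta_mx 0 ord0.
have img_x : img c x by exists q.
have /nbhs_ballP[r /= r0 xr] : nbhs x (img c) by exact: open_nbhs_nbhs.
have e1_gt0 : 0 < `|e| + 1 by rewrite ltr_wpDl.
have xO (s : R) : `|s| < r / (`|e| + 1) -> img c (x + s *: e).
  move=> sr; apply: xr; rewrite -ball_normE/= opprD addrA subrr add0r normrN normrZ.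
  rewrite ltr_pdivlMr// in sr; apply: le_lt_trans sr.
  by rewrite ler_wpM2l// lerDl.
have x0 (i : 'I_n.+1) : (i < k.+1)%N -> x 0 i = 0 by exact: (c_slice q cq).1.
exists (img c), (u \o param c), x, (r / (`|e| + 1)).
split=> //; [exact: us|by rewrite divr_gt0| |]; last first.
  by rewrite /= paramK// (coh1_potential0 coh).
move=> s s0 sr; have [p cp zE] := xO s sr.
have zi (i : 'I_n.+1) : (i < k.+1)%N -> Defs.coord c p 0 i = s * (i == ord0)%:R.
  by move=> ik; rewrite zE !mxE x0// add0r.
have Np : ~ N p.
  move=> /(c_slice p cp)/(_ ord0 isT); rewrite zi// eqxx mulr1 => s0'.
  by move: s0; rewrite s0' eqxx.
have [t [q' [t0 pE]]] := off_orbit Np.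
rewrite pE in cp zi zE.
have [+ _] := c_polar t q' t0 cp.
rewrite (bigD1 ord0)//= big1 => [|i /andP[ik i0]]; last first.
  by rewrite zi// (negbTE i0) mulr0 expr0n.
rewrite addr0 zi// eqxx mulr1 => st.
have <- : t = `|s|.
  by apply/eqP; rewrite -(eqrXn2 (n := 2))// ?ltW// real_normK ?num_real// st.
by rewrite /= -/e -zE paramK// (coh1_potential coh).
Qed.

(** In a product chart the metric is [dt^2 + h(t)], and the potential and the
    mean curvature are functions of the first coordinate; the equations are
    read off along a single line of constant slice coordinates. *)
Lemma profile_ode : exists (y dy ddy H dH q : R -> R),
  [/\ (forall t : R, 0 < t -> is_derive t (1 : R) f (y t)),
      (forall t : R, 0 < t -> is_derive t (1 : R) y (dy t)) &
      (forall t : R, 0 < t -> is_derive t (1 : R) dy (ddy t))] /\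
  [/\ (forall t : R, 0 < t -> is_derive t (1 : R) H (dH t)),
      (forall t : R, 0 < t -> dH t = - q t + dy t + eps / 2),
      (forall t : R, 0 < t ->
        ddy t + (H t - y t) * dy t = (q t + eps / 2) * y t) &
      (forall t : R, 0 < t -> H t ^+ 2 <= n%:R * q t)].
Proof.
have [p0 _] := slice_inhabited.
have [a a_atlas ap0] := atlas_cover p0.
have [c c_atlas c_prod] := coh1_diffeo coh a_atlas.
have [domE coordE] := c_prod.
have [_ img_open paramK _ _] := atlas_chart c_atlas.
have [_ g_metric us sol] := soliton.
pose O : set 'rV[R]_(1 + n) := img c.
have Oo : open O := img_open.
pose tt : 'I_(1 + n) := lshift n ord0.
have O_row (t : R) p : 0 < t -> dom a p -> O (row_mx (t%:M : 'rV[R]_1) (Defs.coord a p)).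
  move=> t0 ap; exists (Phi t p); last exact: coordE.
  by rewrite domE; exists t, p.
have O_inv z : O z -> exists t p,
    [/\ 0 < t, dom a p & z = row_mx (t%:M : 'rV[R]_1) (Defs.coord a p)].
  move=> [m]; rewrite domE => -[t [p [t0 ap ->]]] <-.
  by exists t, p; split=> //; exact: coordE.
have row_tt (t : R) (x : 'rV[R]_n) : row_mx (t%:M : 'rV[R]_1) x 0 tt = t.
  by rewrite /tt row_mxEl mxE eqxx.
pose G : 'rV[R]_(1 + n) -> 'M[R]_(1 + n) := g c.
pose hh z : 'M[R]_n := drsubmx (G z).
have G_row (t : R) p : 0 < t -> dom a p ->
    G (row_mx (t%:M : 'rV[R]_1) (Defs.coord a p))
    = block_mx (1%:M : 'M[R]_1) 0 0 (h t a (Defs.coord a p)).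
  by move=> t0 ap; apply: (coh1_metric coh a_atlas c_atlas c_prod t0); exists p.
have hh_row (t : R) p : 0 < t -> dom a p ->
    hh (row_mx (t%:M : 'rV[R]_1) (Defs.coord a p)) = h t a (Defs.coord a p).
  by move=> t0 ap; rewrite /hh G_row// block_mxKdr.
have G_block z : O z -> G z = block_mx (1%:M : 'M[R]_1) 0 0 (hh z).
  by move=> /O_inv[t [p [t0 ap ->]]]; rewrite hh_row// G_row.
have hs : smooth_mx O hh.
  move=> i j; have s := metric_smooth g_metric (rshift 1 i) (rshift 1 j) c_atlas.
  by apply: (smooth_on_eq Oo _ s) => z _; rewrite !mxE.
have h_pos z : O z -> posdef (hh z).
  move=> /O_inv[t [p [t0 ap ->]]]; rewrite hh_row//.
  have ht := coh1_slice_metric coh t0; have ia : img a (Defs.coord a p) by exists p.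
  split; first exact: (Defs.metric_sym ht a_atlas ia).
  by move=> v v0; exact: (Defs.metric_pos ht a_atlas ia v0).
have h_sym z : O z -> (hh z)^T = hh z by move=> /h_pos[].
have h_unit z : O z -> hh z \in unitmx by move=> /h_pos/posdef_unit.
pose F := u \o param c.
have F_row (t : R) p : 0 < t -> dom a p ->
    F (row_mx (t%:M : 'rV[R]_1) (Defs.coord a p)) = f t.
  move=> t0 ap; rewrite /F /= -(coordE t p t0 ap) paramK ?(coh1_potential coh)//.
  by rewrite domE; exists t, p.
have Fs : smooth_on O F := us c c_atlas.
have F_time i z : O z -> partial (rshift 1 i) F z = 0.
  move=> Oz; apply: etrans (partial_time_only f i z); apply: (partial_eq _ Oo Oz) => w.
  by move=> /O_inv[t [p [t0 ap ->]]]; rewrite F_row// row_tt.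
have [Hc HcE] := coh1_mean_const coh.
pose L := weingarten tt hh.
have L_row (t : R) p : 0 < t -> dom a p ->
    \tr (L (row_mx (t%:M : 'rV[R]_1) (Defs.coord a p))) = Hc t.
  move=> t0 ap; rewrite -(HcE t a (Defs.coord a p) t0 a_atlas); last by exists p.
  rewrite /L weingarten_def /shape_operator /cometric hh_row//.
  congr (\tr (_ *: (_ *m _))).
  apply/matrixP => i j; rewrite pmxE mxE derive1E.
  have d := is_derive_time (smooth_on_derivable (i := tt) (hs i j) (O_row t p t0 ap)).
  rewrite -(@derive_val _ _ _ _ _ _ _ d); apply: near_eq_derive.
  have : \forall s \near t, 0 < s by exact: lt_nbhsr.
  by apply: filterS => s s0; rewrite hh_row.
have H_time i z : O z -> partial (rshift 1 i) (fun x => \tr (L x)) z = 0.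
  move=> Oz; apply: etrans (partial_time_only Hc i z); apply: (partial_eq _ Oo Oz) => w.
  by move=> /O_inv[t [p [t0 ap ->]]]; rewrite L_row// row_tt.
have eqG z : O z -> ricci G z + hessian G F z + (eps / 2) *: G z = 0.
  by move=> Oz; exact: sol.
pose z (t : R) : 'rV[R]_(1 + n) := row_mx (t%:M : 'rV[R]_1) (Defs.coord a p0).
have Oz (t : R) : 0 < t -> O (z t) by move=> t0; exact: O_row.
have Ls : smooth_mx O L := smooth_weingarten Oo tt hs h_unit.
have Hs : smooth_on O (fun x => \tr (L x)) := smooth_mxtrace Oo Ls.
have along (Q : 'rV[R]_(1 + n) -> R) (t : R) : smooth_on O Q -> 0 < t ->
    is_derive t (1 : R) (fun s => Q (z s)) (partial tt Q (z t)).
  by move=> Qs t0; exact: (is_derive_time (smooth_on_derivable Qs (Oz t t0))).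
exists (fun t => partial tt F (z t)), (fun t => partial tt (partial tt F) (z t)),
  (fun t => partial tt (partial tt (partial tt F)) (z t)), (fun t => \tr (L (z t))),
  (fun t => partial tt (fun x => \tr (L x)) (z t)), (fun t => \tr (L (z t) *m L (z t))).
split; split.
- move=> t t0; apply: near_eq_is_derive (along F t Fs t0).
  have : \forall s \near t, 0 < s by exact: lt_nbhsr.
  by apply: filterS => s s0; exact: F_row.
- by move=> t t0; exact: (along _ t (smooth_on_partial tt Fs) t0).
- move=> t t0.
  exact: (along _ t (smooth_on_partial tt (smooth_on_partial tt Fs)) t0).
- by move=> t t0; exact: (along _ t Hs t0).
- by move=> t t0; exact: (soliton_time_time Oo hs h_unit G_block F_time eqG (Oz t t0)).
- move=> t t0.
  exact: (soliton_third_order Oo hs h_sym h_unit G_block Fs F_time H_time eqG (Oz t t0)).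
- move=> t t0; apply: sqr_mxtrace_le (h_pos _ (Oz t t0)) _.
  have <- : 2^-1 *: pmx tt hh (z t) = hh (z t) *m L (z t).
    by rewrite (dt_metric tt h_unit (Oz t t0)) scalerA mulVf ?scale1r// pnatr_eq0.
  by rewrite linearZ/= (dh_sym Oo h_sym tt (Oz t t0)).
Qed.

End Cohomogeneity.

Unset Implicit Arguments.
Set Strict Implicit.

Theorem proposition1p11 (R : realType) (n k : nat)
    (M : manifold R n.+1) (P : manifold R n)
    (g : tensor2 M) (u : M -> R) (eps : R)
    (N : set M) (Phi : R -> P -> M) (h : R -> tensor2 P) (f : R -> R) :
  expanding_gradient_soliton g u eps ->
  complete_metric g ->
  ~ einstein g ->
  cohomogeneity_one k g u N Phi h f ->
  strictly_decreasing_on `]0, +oo[ f /\ strictly_concave_on `]0, +oo[ f.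
Proof.
move=> sol _ not_einstein coh.
have [y [dy [ddy [H [dH [q [[fd yd dyd] [Hd dHE ode Hq]]]]]]]] := profile_ode sol coh.
have [V [F [x [del [Fs del0 xV Ff Fx]]]]] := profile_at_orbit sol coh.
have [lim0 flim] := even_profile_limit Fs del0 xV Ff fd yd.
have [eps_gt0 _ _ solE] := sol.
have n1 : 1 <= (n%:R : R) by rewrite ler1n; exact: dim_gt0 coh.
have [y0|neg] := @soliton_ode_dichotomy R eps n%:R f y dy ddy H dH q
  eps_gt0 n1 fd yd dyd Hd dHE ode Hq lim0; last first.
  exact: strictly_monotone_of_derivatives fd yd neg.
(* A constant potential vanishes everywhere, so its Hessian does. *)
exfalso; apply: not_einstein; exists (- (eps / 2)) => c z c_atlas cz.
have f0 t : 0 < t -> f t = 0.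
  move=> t0; rewrite -(coh1_normalized coh) -Fx.
  have f_cst (s : R) : 0 < s -> f t = f s.
    move=> s0; apply: constant_of_derive0 => // r r0.
    by have := fd r r0; rewrite y0.
  have ft : f s @[s --> 0^'+] --> f t.
    have c0 : (fun=> f t) s @[s --> (0 : R)^'+] --> f t by exact: cvg_cst.
    apply: cvg_trans c0; apply: near_eq_cvg; near=> s.
    by rewrite (f_cst s).
  exact: (cvg_unique _ ft flim).
have u0 p : u p = 0.
  have [Np|/(off_orbit coh)[t [q' [t0 ->]]]] := pselect (N p).
    by rewrite (coh1_potential0 coh) ?(coh1_normalized coh).
  by rewrite (coh1_potential coh)// f0.
have hess0 : hessian (g c) (u \o param c) z = 0.
  have -> : u \o param c = fun=> 0 by apply/funext => w; exact: u0.
  have d0 i : partial i (fun=> 0) = (fun=> 0) :> ('rV[R]_n.+1 -> R).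
    by apply/funext => w; exact: partial_cst.
  apply/matrixP => i j; rewrite mxE d0 partial_cst big1 ?subrr ?mxE// => l _.
  by rewrite d0 mulr0.
have := solE c z c_atlas cz; rewrite hess0 addr0 => /eqP.
by rewrite addr_eq0 -scaleNr => /eqP.
Unshelve. all: by end_near. Qed.
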